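(* The multiple-fragment heuristic for the traveling salesman problem on $n$ sites can be implemented in time $O(n^2)$. It can also be implemented in time $O(n^2\log^2 n)$ and space $O(n)$.
   Context: The input is a set of $n$ sites with a (symmetric) distance function $d$, not necessarily satisfying the triangle inequality; each site is stored in constant space, $d$ is evaluated in constant time, and two distances are compared in constant time. The multiple-fragment heuristic is the following: consider all edges (pairs of sites) one at a time in sorted order of length, and include an edge if it connects the endpoints of two different fragments of tours, where a fragment is a connected component (a path, possibly a single site) of the previously included edges. When only one fragment remains, its endpoints are joined to give a tour. Ties in the order may be broken arbitrarily. *)

(* Defs.v *)
From HB Require Import structures.
From mathcomp Require Import all_boot all_order all_algebra.
From mathcomp Require Import classical_sets reals topology normedtype landau sequences exp.

Set Implicit Arguments.
Unset Strict Implicit.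
Unset Printing Implicit Defensive.

Import Order.TTheory GRing.Theory Num.Theory.

(** * The multiple-fragment heuristic *)

Definition adj (S : finType) (F : seq (S * S)) : rel S :=
  fun x y => ((x, y) \in F) || ((y, x) \in F).

(* Fragments are the connected components of [adj F]; an isolated site (degree
   0) is the unique endpoint of its fragment. *)
Definition endpoint (S : finType) (F : seq (S * S)) (x : S) : bool :=
  #|[set y | adj F x y]| <= 1.

Definition joins_fragments (S : finType) (F : seq (S * S)) (e : S * S) : bool :=
  [&& endpoint F e.1, endpoint F e.2 & ~~ connect (adj F) e.1 e.2].

Definition mf_edges (S : finType) (es : seq (S * S)) : seq (S * S) :=
  foldl (fun F e => if joins_fragments F e then e :: F else F) [::] es.

(* [es] lists every unordered pair of distinct sites exactly once, in one of
   its two orientations and never a loop, by nondecreasing length. *)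
Definition sorted_edges (R : realType) (S : finType) (d : S -> S -> R)
    (es : seq (S * S)) : Prop :=
  (forall x y : S, count_mem (x, y) es + count_mem (y, x) es = (x != y))
  /\ sorted (fun e f => (d e.1 e.2 <= d f.1 f.2)%R) es.

(* A tour is given by the sites in cyclic order.  Once a single fragment
   remains it is a Hamiltonian path [p]; joining its two endpoints closes [p]
   into a cyclic order, which may be written down from any starting site.  The
   existential on [es] is the arbitrary breaking of ties. *)
Definition mf_tour (R : realType) (S : finType) (d : S -> S -> R)
    (t : seq S) : Prop :=
  exists (es : seq (S * S)) (p : seq S) (k : nat),
    [/\ sorted_edges d es, perm_eq p (enum S),
        sorted (adj (mf_edges es)) p & t = rot k p].

(** * A unit-cost random access machine with a distance oracle *)

(* One word of storage: an integer, a site or a distance.  Sites and distances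
   are opaque: the machine can only copy them, evaluate the distance of two
   sites and compare two distances. *)
Inductive word (S R : Type) : Type :=
  | Int of nat
  | Site of S
  | Dist of R.
Arguments Int {S R} _.
Arguments Site {S R} _.
Arguments Dist {S R} _.

Inductive instr : Type :=
  | Const of nat & nat        (* r := k *)
  | Move of nat & nat         (* r := a *)
  | Add of nat & nat & nat    (* r := a + b *)
  | Sub of nat & nat & nat    (* r := a - b, truncated at 0 *)
  | Read of nat & nat         (* r := mem[a] *)
  | Write of nat & nat        (* mem[a] := b *)
  | GetDist of nat & nat & nat (* r := d(a, b) *).

Inductive test : Type :=
  | EqInt of nat & nat
  | LtInt of nat & nat
  | LeDist of nat & nat.

Inductive program : Type :=
  | Skip
  | Do of instr
  | Seq of program & program
  | If of test & program & program
  | While of test & program.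

(* A program mentions finitely many registers, so only [mem] counts as space. *)
Record state (S R : Type) : Type := State {
  reg : nat -> word S R;
  mem : nat -> word S R }.

Definition update (V : Type) (f : nat -> V) (k : nat) (v : V) : nat -> V :=
  fun i => if i == k then v else f i.

Definition set_reg (S R : Type) (st : state S R) (r : nat) (v : word S R) :=
  State (update (reg st) r v) (mem st).

(* [M] is the number of memory cells, [w] the number of bits of an integer
   word.  [None] is a failure: ill-typed operand, address outside the memory, or
   integer overflow. *)
Definition run_instr (R : realType) (S : Type) (d : S -> S -> R) (M w : nat)
    (i : instr) (st : state S R) : option (state S R) :=
  let set_int r k :=
    if k < 2 ^ w then Some (set_reg st r (Int k)) else None in
  match i with
  | Const r k => set_int r k
  | Move r a => Some (set_reg st r (reg st a))
  | Add r a b =>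
      if (reg st a, reg st b) is (Int x, Int y) then set_int r (x + y)
      else None
  | Sub r a b =>
      if (reg st a, reg st b) is (Int x, Int y) then set_int r (x - y)
      else None
  | Read r a =>
      if reg st a is Int x then
        if x < M then Some (set_reg st r (mem st x)) else None
      else None
  | Write a b =>
      if reg st a is Int x then
        if x < M then Some (State (reg st) (update (mem st) x (reg st b)))
        else None
      else None
  | GetDist r a b =>
      if (reg st a, reg st b) is (Site x, Site y) then
        Some (set_reg st r (Dist (d x y)))
      else None
  end.

Definition run_test (R : realType) (S : Type) (c : test) (st : state S R) :
    option bool :=
  match c with
  | EqInt a b =>
      if (reg st a, reg st b) is (Int x, Int y) then Some (x == y) else None
  | LtInt a b =>
      if (reg st a, reg st b) is (Int x, Int y) then Some (x < y) else None
  | LeDist a b =>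
      if (reg st a, reg st b) is (Dist x, Dist y) then Some (x <= y)%R
      else None
  end.

(* [exec d M w P st k st']: started in [st] on a machine with [M] cells of [w]
   bits, [P] halts without failure in [st'] after [k] unit-cost steps. *)
Inductive exec (R : realType) (S : Type) (d : S -> S -> R) (M w : nat) :
    program -> state S R -> nat -> state S R -> Prop :=
  | ExecSkip st : exec d M w Skip st 0 st
  | ExecDo i st st' :
      run_instr d M w i st = Some st' -> exec d M w (Do i) st 1 st'
  | ExecSeq P Q st st1 st2 k l :
      exec d M w P st k st1 -> exec d M w Q st1 l st2 ->
      exec d M w (Seq P Q) st (k + l) st2
  | ExecIf c P Q b st st' k :
      run_test c st = Some b -> exec d M w (if b then P else Q) st k st' ->
      exec d M w (If c P Q) st k.+1 st'
  | ExecWhileDone c P st :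
      run_test c st = Some false -> exec d M w (While c P) st 1 st
  | ExecWhileStep c P st st1 st2 k l :
      run_test c st = Some true ->
      exec d M w P st k st1 -> exec d M w (While c P) st1 l st2 ->
      exec d M w (While c P) st (k + l).+1 st2.

(* The sites occupy the first cells; register 0 holds their number. *)
Definition init_state (R : realType) (S : Type) (s : seq S) : state S R :=
  State (fun r => if r == 0 then Int (size s) else Int 0)
        (fun i => nth (Int 0) (map Site s) i).

(* At the end, the first cells hold the tour.  [T], [M] and [w] bound the time,
   the space (including the input) and the word length in terms of the number of
   sites, for all inputs of that size. *)
Definition implements_mf (R : realType) (P : program) (T M w : nat -> nat) :
    Prop :=
  forall (S : finType) (d : S -> S -> R) (s : seq S),
    (forall x y, d x y = d y x) ->
    perm_eq s (enum S) ->
    let n := #|S| in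
    [/\ n <= M n, n < 2 ^ w n &
      exists (k : nat) (st : state S R) (t : seq S),
        [/\ exec d (M n) (w n) P (init_state R s) k st, k <= T n,
            [seq mem st i | i <- iota 0 n] = map Site t & mf_tour d t]].

(* Main.v *)
(* One program, running in time O(n^2) and space O(n), proves both halves.  Call an
   edge live if it joins two current fragments, and near a live edge if it meets
   either of the two fragments that this edge joins.  If a live edge [e] is
   shortest among the live edges near it, then the greedy algorithm includes [e],
   since it cannot touch these two fragments before it reaches [e]; so such edges
   may be included in any order, and ties are broken in hindsight in favour of the
   edges included.  To find such edges, keep a stack of live edges, each one
   strictly shorter than the edge below it and shortest among the live edges near
   the edge below.  Scanning the edges near the top in time O(n) either yields a
   strictly shorter edge, which is pushed, or shows that the top can be included.
   Including it invalidates, apart from itself, at most the entry directly below,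
   because the lower entries have no fragment in common with it.  Hence there are
   O(n) scans. *)
Require Import Defs.
From HB Require Import structures.
From mathcomp Require Import all_boot all_order all_algebra.
From mathcomp Require Import classical_sets reals topology normedtype landau sequences exp.
From mathcomp Require Import boolp.
From mathcomp Require Import zify.

Import Order.TTheory GRing.Theory Num.Theory.
Import numFieldNormedType.Exports.

Set Implicit Arguments.
Unset Strict Implicit.
Unset Printing Implicit Defensive.

(** * Greedy inclusion of locally shortest edges *)

Section Graph.
Variable S : finType.
Implicit Types (F : seq (S * S)) (e x : S * S).

Lemma adj_sym F : symmetric (adj F).
Proof. by move=> x y; rewrite /adj orbC. Qed.

Lemma adj_connect_sym F : connect_sym (adj F).
Proof. exact/sym_connect_sym/adj_sym. Qed.

Lemma adj_cons e F u v :
  adj (e :: F) u v = [|| e == (u, v), e == (v, u) | adj F u v].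
Proof.
rewrite /adj !inE !(eq_sym _ e).
by case: (e == (u, v)); case: (e == (v, u)); rewrite ?orbT.
Qed.

Lemma sub_adj_cons e F : subrel (adj F) (adj (e :: F)).
Proof. by move=> u v; rewrite adj_cons => ->; rewrite !orbT. Qed.

Lemma connect_cons_sub e F : subrel (connect (adj F)) (connect (adj (e :: F))).
Proof. by apply: connect_sub => u v uv; apply/connect1/sub_adj_cons. Qed.

(** The component of [u] contains neither end of [e], so it stays closed under the enlarged
    adjacency. *)
Lemma connect_cons e F u : ~~ connect (adj F) e.1 u -> ~~ connect (adj F) e.2 u ->
  connect (adj (e :: F)) u =1 connect (adj F) u.
Proof.
rewrite !(adj_connect_sym F _ u) => n1 n2 v.
apply/idP/idP; last exact: connect_cons_sub.
have cl : fingraph.closed (adj (e :: F)) [pred z | connect (adj F) u z].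
  move=> x y; rewrite adj_cons !inE => /or3P[/eqP E|/eqP E|xy].
  - by move: n1 n2; rewrite E /= => /negbTE-> /negbTE->.
  - by move: n1 n2; rewrite E /= => /negbTE-> /negbTE->.
  - by rewrite (same_connect1r (adj_connect_sym F) xy).
by move=> /(closed_connect cl); rewrite !inE connect0 => <-.
Qed.

Lemma endpoint_cons_sub e F u : endpoint (e :: F) u -> endpoint F u.
Proof.
apply: leq_trans; apply/subset_leq_card/fintype.subsetP => v.
by rewrite !inE; apply: sub_adj_cons.
Qed.

Lemma adj_cons_neq e F u v : u != e.1 -> u != e.2 -> adj (e :: F) u v = adj F u v.
Proof.
case: e => a b /= ua ub; rewrite adj_cons !xpair_eqE.
by rewrite (eq_sym a u) (negbTE ua) (eq_sym b u) (negbTE ub) andbF.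
Qed.

Lemma endpoint_cons e F u : u != e.1 -> u != e.2 -> endpoint (e :: F) u = endpoint F u.
Proof.
move=> n1 n2; rewrite /endpoint; congr (_ <= 1); apply: eq_card => v.
by rewrite !inE adj_cons_neq.
Qed.

Lemma joins_cons_sub e F x : joins_fragments (e :: F) x -> joins_fragments F x.
Proof.
case/and3P=> /endpoint_cons_sub E1 /endpoint_cons_sub E2 C.
by rewrite /joins_fragments E1 E2; apply: contra C; apply: connect_cons_sub.
Qed.

Lemma eq_joins F F' : adj F =2 adj F' -> joins_fragments F =1 joins_fragments F'.
Proof.
move=> E x; rewrite /joins_fragments (eq_connect E) /endpoint.
by congr [&& _ <= 1, _ <= 1 & _]; apply: eq_card => v; rewrite !inE E.
Qed.

(** This is the nearness of the overview; liveness is required separately wherever it is used. *)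
Definition touches F e x :=
  [|| connect (adj F) e.1 x.1, connect (adj F) e.1 x.2,
      connect (adj F) e.2 x.1 | connect (adj F) e.2 x.2].

Lemma touchesC F e x : touches F e x = touches F x e.
Proof.
rewrite /touches !(adj_connect_sym F e.1) !(adj_connect_sym F e.2).
by congr orb; rewrite orbCA.
Qed.

Lemma touches_cons e F c x : ~~ touches F e c -> touches (e :: F) c x = touches F c x.
Proof. by case/norP=> ? /norP[? /norP[? ?]]; rewrite /touches !connect_cons. Qed.

(** Including [e] changes degrees and components only within the two fragments that [e] meets. *)
Lemma joins_cons e F x : ~~ touches F e x -> joins_fragments F x ->
  joins_fragments (e :: F) x.
Proof.
case/norP=> n11 /norP[n12 /norP[n21 n22]] /and3P[E1 E2 C].
have neq u v : ~~ connect (adj F) u v -> v != u.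
  by apply: contraNneq => ->; apply: connect0.
by apply/and3P; split; rewrite ?endpoint_cons ?connect_cons ?neq.
Qed.

Lemma joins_consN e F : joins_fragments (e :: F) e = false.
Proof.
apply/negbTE/negP => /and3P[_ _ /negP[]]; apply: connect1.
by rewrite adj_cons -surjective_pairing eqxx.
Qed.

(** The function folded in [mf_edges], named so that a greedy run can start from edges that are
    already included. *)
Definition mf_step F e := if joins_fragments F e then e :: F else F.

Lemma eq_mf_step F F' e : adj F =2 adj F' -> adj (mf_step F e) =2 adj (mf_step F' e).
Proof.
move=> E; rewrite /mf_step (eq_joins E); case: ifP => // _ u v.
by rewrite !adj_cons E.
Qed.

Lemma eq_mf_foldl F F' es : adj F =2 adj F' ->
  adj (foldl mf_step F es) =2 adj (foldl mf_step F' es).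
Proof. by elim: es F F' => [|e es IH] F F' E //=; apply/IH/eq_mf_step. Qed.

Lemma mf_foldl_sub F es : subrel (adj F) (adj (foldl mf_step F es)).
Proof.
elim: es F => [|e es IH] F u v uv //=; apply: IH.
by rewrite /mf_step; case: ifP => // _; apply: sub_adj_cons.
Qed.

(* The greedy algorithm cannot touch the fragments of [e] before it reaches [e],
   so that [e] may as well be included at the start. *)
Lemma mf_foldl_local F e es1 es2 : joins_fragments F e ->
  (forall x, x \in es1 -> joins_fragments F x -> ~~ touches F e x) ->
  adj (foldl mf_step F (es1 ++ e :: es2))
    =2 adj (foldl mf_step (e :: F) (es1 ++ e :: es2)).
Proof.
elim: es1 F => [|x es1 IH] F /= Fe Hes1.
  by rewrite /mf_step Fe joins_consN.
rewrite {2}/mf_step {3}/mf_step.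
case: ifPn => [Fx|nFx]; last first.
  (* An edge rejected without [e] is rejected with [e] as well, so both runs skip [x]. *)
  rewrite (negbTE (contra (@joins_cons_sub _ _ _) nFx)).
  by apply: IH => // y yes1; apply: Hes1; rewrite inE yes1 orbT.
have nex : ~~ touches F e x by apply: Hes1; rewrite ?inE ?eqxx.
rewrite joins_cons // => u v.
have nxe : ~~ touches F x e by rewrite touchesC.
rewrite IH; first last.
- move=> y yes1 /joins_cons_sub Fy; rewrite touches_cons //.
  by apply: Hes1; rewrite // inE yes1 orbT.
- exact: joins_cons.
(* Both runs have now included [x] and [e], in opposite orders; only the resulting adjacency
   matters. *)
apply: eq_mf_foldl => y z; rewrite !adj_cons.
by case: (_ == _); case: (_ == _); case: (_ == _); case: (_ == _).
Qed.

End Graph.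

(** * Runs that include locally shortest edges, and the greedy order that reproduces them *)

Section Good.
Variables (R : realType) (S : finType) (d : S -> S -> R).
Implicit Types (F : seq (S * S)) (e x : S * S).

Definition len e := d e.1 e.2.

Definition locally_min F e :=
  forall x, joins_fragments F x -> touches F e x -> (len e <= len x)%R.

(** [F] is read as a history, latest inclusion first: liveness and minimality are required at the
    moment of inclusion, relative to the tail. *)
Fixpoint good F : Prop :=
  if F is e :: F' then [/\ joins_fragments F' e, locally_min F' e & good F'] else True.

(** An included edge connects its ends, so it is never included again in either orientation. *)
Lemma good_count F u v : good F ->
  count_mem (u, v) F + count_mem (v, u) F = adj F u v.
Proof.
elim: F => [|e F IH] //= [/and3P[_ _ C] _ /IH E].
rewrite addnACA E adj_cons.
have Nadj w z : e = (w, z) -> adj F w z = false.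
  by move=> E'; apply/negbTE; apply: contra C => /connect1; rewrite E'.
have [E1|_] := eqVneq e (u, v); have [E2|_] := eqVneq e (v, u) => //=.
- by move: E2 C; rewrite E1 => -[-> _]; rewrite connect0.
- by rewrite Nadj.
- by rewrite adj_sym Nadj.
Qed.

Definition lep : rel (S * S) := fun e x => (len e <= len x)%R.

(* The sort is stable: listing the edges of [F] first, in the order of their
   inclusion, breaks the ties in their favour. *)
Definition edge_order F : seq (S * S) :=
  sort lep (rev F ++ [seq e <- enum {: S * S} |
                       ~~ adj F e.1 e.2 & enum_rank e.1 < enum_rank e.2]).

Lemma sorted_edge_order F : good F -> sorted_edges d (edge_order F).
Proof.
move=> gF; split; last by apply: sort_sorted => x y; apply: le_total.
have cE u v : count_mem (u, v) (edge_order F) = count_mem (u, v) F +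
    (~~ adj F u v && (enum_rank u < enum_rank v)).
  rewrite /edge_order (permP (permEl (perm_sort _ _))) count_cat count_rev.
  congr (_ + _); rewrite count_uniq_mem; last exact/filter_uniq/enum_uniq.
  by rewrite mem_filter mem_enum inE andbT.
move=> u v; rewrite !cE addnACA good_count // (adj_sym F v u).
case: (boolP (adj F u v)) => /= [uv|nuv].
  case: eqP uv => // <-; rewrite /adj orbb.
  elim: F gF {cE} => //= e F IH [/and3P[_ _ C] _ gF].
  rewrite inE => /orP[/eqP E|/(IH gF)//].
  by case/negP: C; rewrite -E connect0.
(* For a pair outside [F], the comparison of ranks keeps exactly one orientation, and none for a
   loop. *)
rewrite -(inj_eq enum_rank_inj) -(inj_eq val_inj) /=.
by case: ltngtP.
Qed.

Lemma uniq_edge_order F : good F -> uniq (edge_order F).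
Proof.
case/sorted_edge_order=> c _; apply: count_mem_uniq => -[u v].
rewrite -has_pred1 has_count.
by move: (c u v); case: (count_mem _ _) => [|[|k]] //; case: (u != v).
Qed.

(** The inclusions are preloaded one at a time, in the order in which they happened; by
    [mf_foldl_local] each preloading leaves the outcome of the greedy run unchanged. *)
Lemma mf_edges_good F : good F -> subrel (adj F) (adj (mf_edges (edge_order F))).
Proof.
move=> gF; set es := edge_order F.
suff H F2 F1 : F = F2 ++ F1 -> adj (mf_edges es) =2 adj (foldl (@mf_step S) F1 es).
  by move=> u v uv; rewrite (H [::] F) //; apply: mf_foldl_sub.
elim: F1 F2 => [//|e F1 IH] F2 EF u v.
rewrite (IH (rcons F2 e)) ?cat_rcons //.
have ges: good (e :: F1) by move: gF; rewrite EF; elim: F2 {EF} => //= ? ? IH' [].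
have [Fe Le gF1] := ges.
have ees : e \in es.
  by rewrite mem_sort mem_cat mem_rev EF mem_cat mem_head orbT.
have ues := uniq_edge_order gF.
have [es1 [es2 Ees]] : exists es1 es2, es = es1 ++ e :: es2.
  by case/splitPr: ees ues => p1 p2 _; exists p1, p2.
(* Suppose that a live edge [x] near [e] is listed before [e]. It is no shorter than [e], and being
   live it is not in [F1]; so it follows [e] in the unsorted list, and stability of the sort puts it
   after [e]. *)
rewrite Ees; apply: mf_foldl_local => // x xes1 Fx; apply/negP => mx.
have lex := Le x Fx mx.
have nx : x \notin F1.
  case/and3P: Fx => _ _; apply: contra => xF1; apply: connect1.
  by rewrite /adj -surjective_pairing xF1.
have nex : x != e.
  move: ues; rewrite -/es Ees cat_uniq => /and3P[_ /hasPn/(_ e)].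
  rewrite mem_head => /(_ isT) nes1 _.
  by apply: contraNneq nes1 => <-.
have xX: x \in e :: rev F2 ++ [seq e <- enum {: S * S} |
                       ~~ adj F e.1 e.2 & enum_rank e.1 < enum_rank e.2].
  have : x \in es by rewrite Ees mem_cat xes1.
  rewrite mem_sort inE (negbTE nex) !mem_cat !mem_rev {1}EF mem_cat inE.
  by rewrite (negbTE nx) (negbTE nex) !orbF.
have: mem2 es e x.
  rewrite /es /edge_order; apply: mem2_sort => //.
  - by move=> ? ?; apply: le_total.
  - by move=> ? ? ?; apply: le_trans.
  rewrite {1}EF rev_cat rev_cons cat_rcons -catA cat_cons mem2_cat.
  by rewrite [mem2 (_ :: _) _ _]mem2_cons eqxx xX orbT.
have ne1 : e \notin es1.
  move: ues; rewrite -/es Ees cat_uniq => /and3P[_ /hasPn/(_ e) + _].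
  by rewrite mem_head => /(_ isT).
rewrite Ees mem2l_cat // mem2_cons eqxx => xes2.
move: ues; rewrite -/es Ees cat_uniq => /and3P[_ /hasPn/(_ x xes2)].
by rewrite /= xes1.
Qed.

End Good.

(** * The stack and the fragments *)

Section Chain.
Variables (R : realType) (S : finType) (d : S -> S -> R).
Implicit Types (F s : seq (S * S)) (e c x : S * S).

(** The bound [l] is a number because it will be the length of another edge, namely the one above
    [e] on the stack or the result of a scan. *)
Definition min_nearby F e (l : R) :=
  forall x, joins_fragments F x -> touches F e x -> (l <= len d x)%R.

(** The bound is required near all lower entries rather than only the next one; this is what
    separates the top from the entries two or more below it. *)
Fixpoint descending F s : Prop :=
  if s is e :: s' then
    [/\ joins_fragments F e, forall c, c \in s' -> min_nearby F c (len d e),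
        (if s' is c :: _ then (len d e < len d c)%R else true) & descending F s']
  else True.

Lemma descending_push F e c s : descending F (c :: s) -> joins_fragments F e ->
  min_nearby F c (len d e) -> (len d e < len d c)%R -> descending F [:: e, c & s].
Proof.
move=> ch Fe me lt; split=> // b; rewrite inE => /predU1P[->//|bs] x Fx mx.
by case: ch => _ /(_ b bs x Fx mx) + _ _; apply: le_trans (ltW lt).
Qed.

(** If [e] were near [b], the bound recorded for [c] near [b] would give [len d c <= len d e],
    against the strict descent. *)
Lemma descending_far F e c s b : descending F [:: e, c & s] -> b \in s -> ~~ touches F e b.
Proof.
case=> Fe _ lt [_ mc _ _] bs; rewrite touchesC.
by apply/negP => /(mc b bs e Fe); rewrite leNgt lt.
Qed.

(** Inclusion makes no new edge live and leaves the fragments of far entries alone, so liveness and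
    the recorded bounds survive. *)
Lemma descending_cons F e s : (forall c, c \in s -> ~~ touches F e c) -> descending F s ->
  descending (e :: F) s.
Proof.
elim: s => //= c s IH far [Fc mc lt ch]; split=> //.
- by apply: joins_cons; rewrite ?far ?mem_head.
- move=> b bs x /joins_cons_sub Fx.
  by rewrite touches_cons ?far ?inE ?bs ?orbT//; apply: mc.
- by apply: IH => // b bs; rewrite far // inE bs orbT.
Qed.

Lemma descending_merge F e s : descending F (e :: s) -> descending (e :: F) (behead s).
Proof.
case: s => [|c s] // ch; apply: descending_cons; last by case: ch => _ _ _ [].
by move=> b; apply: descending_far ch.
Qed.

(** The list [t] collects the ends of every second entry. These entries share no fragment, so their
    ends are distinct, and two ends pay for two entries. The last clause on [t] keeps the ends of
    the top out of the list built from the entries two or more below. *)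
Lemma descending_size F s : descending F s -> size s <= #|S|.
Proof.
suff: descending F s -> exists t : seq S, [/\ uniq t, size s <= size t &
    forall x : S, x \in t -> exists2 c, c \in s &
      connect (adj F) c.1 x || connect (adj F) c.2 x].
  by move=> H /H[t [ut /leq_trans-> //]]; rewrite -(card_uniqP ut) max_card.
elim: {s}(size s) {-2}s (leqnn (size s)) => [|k IH] [|e s] //=; try by exists [::].
rewrite ltnS => sk ch; have [/and3P[_ _ C] _ _ ch'] := ch.
have nee : e.1 != e.2 by apply: contraNneq C => ->; apply: connect0.
case: s sk ch ch' => [|c s] /= sk ch ch'.
  exists [:: e.1; e.2]; rewrite /= inE nee; split=> // x; rewrite !inE.
  by move=> /orP[]/eqP->; exists e; rewrite ?inE ?connect0 ?orbT.
have [t [ut st tP]] := IH s (ltnW sk) (let: And4 _ _ _ ch2 := ch' in ch2).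
have nt z : z \in t -> (z != e.1) && (z != e.2).
  move=> /tP[b bs]; have /norP[n11 /norP[n12 /norP[n21 n22]]] := descending_far ch bs.
  rewrite -negb_or; apply: contraTN => /orP[]/eqP->.
    by rewrite ![connect _ _ e.1]adj_connect_sym negb_or n11.
  by rewrite ![connect _ _ e.2]adj_connect_sym negb_or n21.
exists [:: e.1, e.2 & t]; split.
- rewrite /= inE negb_or nee ut andbT /=.
  by apply/andP; split; apply/negP => /nt; rewrite eqxx ?andbF.
- by rewrite /= !ltnS.
- move=> x; rewrite !inE => /or3P[/eqP->|/eqP->|/tP[b bs bx]].
  + by exists e; rewrite ?mem_head ?connect0.
  + by exists e; rewrite ?mem_head ?connect0 ?orbT.
  + by exists b; rewrite // !inE bs !orbT.
Qed.

End Chain.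

(** * Fragments as paths, their mates and their neighbour sums *)

Section Fragments.
Variables (S : finType) (ix : S -> nat).
Hypotheses (ix_inj : injective ix) (ix_lt : forall x, ix x < #|S|).
Implicit Types (F : seq (S * S)) (x y a b : S) (f g : seq S) (m : S -> nat).

(** The value [#|S|] is the index of no site and marks interior sites; the only site of a trivial
    fragment is its own mate. *)
Definition mate_in f x : nat :=
  if x == head x f then ix (last x f)
  else if x == last x f then ix (head x f) else #|S|.

(** The list gives the fragment in path order. Closure makes it a whole component, and the degree
    equation excludes edges other than those of the path. *)
Definition fragment F m f : Prop :=
  [/\ f != [::], sorted (adj F) f, fingraph.closed (adj F) f,
      forall x, x \in f -> #|[set y | adj F x y]| = (x != head x f) + (x != last x f) &
      forall x, x \in f -> m x = mate_in f x].

Definition fragments F m (fs : seq (seq S)) : Prop :=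
  perm_eq (flatten fs) (enum S) /\ forall f, f \in fs -> fragment F m f.

Lemma head_rev_last x f : head x (rev f) = last x f.
Proof. by case/lastP: f => // f y; rewrite rev_rcons last_rcons. Qed.

Lemma last_rev_head x f : last x (rev f) = head x f.
Proof. by rewrite -[in RHS](revK f) head_rev_last. Qed.

Lemma fragment_rev F m f : fragment F m f -> fragment F m (rev f).
Proof.
case=> nf pf cf df mf; split.
- by rewrite -size_eq0 size_rev size_eq0.
- by rewrite rev_sorted; apply: sub_sorted pf => x y; rewrite adj_sym.
- by move=> x y xy; rewrite !mem_rev; apply: cf.
- by move=> x; rewrite mem_rev head_rev_last last_rev_head addnC; apply: df.
- move=> x; rewrite mem_rev => /mf ->.
  rewrite /mate_in head_rev_last last_rev_head.
  case: (x =P head x f) => [h|_]; case: (x =P last x f) => [l|_] //.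
  by rewrite -h -l.
Qed.

Lemma fragments_perm F m fs fs' : perm_eq fs fs' -> fragments F m fs -> fragments F m fs'.
Proof.
move=> pfs [pf Ff]; split; last by move=> f; rewrite -(perm_mem pfs); apply: Ff.
by apply: perm_trans pf; rewrite perm_sym; apply: perm_flatten.
Qed.

Lemma fragments_rev F m f fs : fragments F m (f :: fs) -> fragments F m (rev f :: fs).
Proof.
case=> pf Ff; split.
  by apply: perm_trans pf; rewrite /= perm_cat2r perm_rev.
move=> g; rewrite inE => /predU1P[->|gfs]; last by apply: Ff; rewrite inE gfs orbT.
by apply/fragment_rev/Ff/mem_head.
Qed.

Lemma fragments_mem F m fs x : fragments F m fs -> exists2 f, f \in fs & x \in f.
Proof. by case=> pf _; apply/flattenP; rewrite (perm_mem pf) mem_enum. Qed.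

Lemma fragments_uniq F m fs : fragments F m fs -> uniq (flatten fs).
Proof. by case=> pf _; rewrite (perm_uniq pf) enum_uniq. Qed.

Lemma fragments_size F m fs : fragments F m fs -> size fs <= #|S|.
Proof.
case=> pf Ff; rewrite cardT -(perm_size pf).
have {pf Ff}: forall f, f \in fs -> f != [::] by move=> f /Ff[].
elim: fs => //= f fs IH nf; rewrite size_cat -add1n leq_add //.
  by rewrite lt0n size_eq0 nf ?mem_head.
by apply: IH => g gfs; rewrite nf // inE gfs orbT.
Qed.

Lemma fragment_connect F m f x y : fragment F m f -> x \in f ->
  connect (adj F) x y = (y \in f).
Proof.
case=> _ pf cf _ _ xf; apply/idP/idP; first by move/(closed_connect cf) <-.
case: f xf pf {cf} => // z f xf pf yf.
have czf w : w \in z :: f -> connect (adj F) z w.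
  by move=> wf; apply: path_connect pf _ wf.
by rewrite -(same_connect (adj_connect_sym F) (czf _ xf)) czf.
Qed.

Lemma fragment_endpoint F m f x : fragment F m f -> x \in f ->
  endpoint F x = (x == head x f) || (x == last x f).
Proof.
by case=> _ _ _ df _ xf; rewrite /endpoint df //; case: (_ == _); case: (_ == _).
Qed.

Lemma head_in x f : x \in f -> head x f \in f.
Proof. by case: f => //= y f _; rewrite mem_head. Qed.

Lemma last_in x f : x \in f -> last x f \in f.
Proof. by case: f => //= y f _; rewrite mem_last. Qed.

Lemma head_default x y f : x \in f -> head y f = head x f.
Proof. by case: f. Qed.

Lemma last_default x y f : x \in f -> last y f = last x f.
Proof. by case: f. Qed.

(** The form in which the program relies on the mate array: mates are mutual, and a fragment has no
    third endpoint. *)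
Lemma fragment_mate F m f x : fragment F m f -> x \in f -> endpoint F x ->
  exists x', [/\ m x = ix x', endpoint F x', connect (adj F) x x', m x' = ix x &
    forall y, endpoint F y -> connect (adj F) x y -> y = x \/ y = x'].
Proof.
move=> Ff xf; have [_ _ _ _ mf] := Ff.
set h := head x f; set l := last x f.
have endE y : y \in f -> endpoint F y = (y == h) || (y == l).
  by move=> yf; rewrite (fragment_endpoint Ff) // (head_default y xf) (last_default y xf).
have mE y : y \in f -> m y = if y == h then ix l else if y == l then ix h else #|S|.
  by move=> yf; rewrite mf // /mate_in (head_default y xf) (last_default y xf).
have hf : h \in f by apply: head_in.
have lf : l \in f by apply: last_in.
have mh : m h = ix l by rewrite mE ?eqxx.
have ml : m l = ix h by rewrite mE ?eqxx //; case: eqP => [->|].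
have cE y z : y \in f -> connect (adj F) y z = (z \in f) := @fragment_connect F m f y z Ff.
rewrite endE // => /orP[]/eqP->; [exists l|exists h]; rewrite endE // cE // eqxx ?orbT.
all: split=> // y Ey; rewrite cE // => yf.
all: by move: Ey; rewrite endE // => /orP[]/eqP; auto.
Qed.

Lemma fragments_mate F m fs x : fragments F m fs -> endpoint F x ->
  exists x', [/\ m x = ix x', endpoint F x', connect (adj F) x x', m x' = ix x &
    forall y, endpoint F y -> connect (adj F) x y -> y = x \/ y = x'].
Proof.
move=> Ffs; have [f ffs xf] := fragments_mem x Ffs.
by apply: fragment_mate xf; apply: Ffs.2.
Qed.

Lemma fragments_endpoint F m fs x : fragments F m fs -> (m x < #|S|) = endpoint F x.
Proof.
move=> Ffs; apply/idP/idP; last by case/(fragments_mate Ffs) => x' [->].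
have [f ffs xf] := fragments_mem x Ffs; have Ff := Ffs.2 f ffs.
have [_ _ _ _ mf] := Ff; rewrite mf // (fragment_endpoint Ff) // /mate_in.
by case: (x == head x f); case: (x == last x f); rewrite ?ltnn.
Qed.

(** The only endpoints in the fragment of [x] are [x] and its mate, so two comparisons of integers
    decide liveness. *)
Lemma fragments_joins F m fs x y : fragments F m fs -> endpoint F x -> endpoint F y ->
  joins_fragments F (x, y) = (y != x) && (ix y != m x).
Proof.
move=> Ffs Ex Ey; have [x' [mx Ex' cx _ all]] := fragments_mate Ffs Ex.
rewrite /joins_fragments Ex Ey /= mx (inj_eq ix_inj) -negb_or; congr (~~ _).
apply/idP/orP => [/all[]// ->|[]/eqP->]; rewrite ?eqxx ?connect0 //; by [left|right].
Qed.

Lemma fragments_init : fragments [::] ix [seq [:: x] | x <- enum S].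
Proof.
split; first by rewrite flatten_seq1.
move=> _ /mapP[x _ ->]; split=> // y; rewrite inE => /eqP->; rewrite /= ?eqxx.
  by apply: eq_card0 => z; rewrite !inE.
by rewrite /mate_in /= eqxx.
Qed.

Lemma flatten_uniq_disjoint (fs : seq (seq S)) f g x :
  uniq (flatten (f :: fs)) -> x \in f -> g \in fs -> x \notin g.
Proof.
rewrite /= cat_uniq => /and3P[_ /hasPn H _] xf gfs.
by apply: contraTN xf => xg; apply: H; apply/flattenP; exists g.
Qed.

(** The four writes of [merge_top], the last one tested first. The order matters for one-site
    fragments, where [a' = a] or [b' = b]. *)
Definition link_mate m a b a' b' x : nat :=
  if x == b' then ix a' else if x == a' then ix b'
  else if x == b then #|S| else if x == a then #|S| else m x.

Lemma joins_card a b F x : joins_fragments F (a, b) ->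
  #|[set y | adj ((a, b) :: F) x y]| = #|[set y | adj F x y]| + (x == a) + (x == b).
Proof.
case/and3P=> /= _ _ C.
have nab : a != b by apply: contraNneq C => ->.
have [Fab Fba] : adj F a b = false /\ adj F b a = false.
  by rewrite (adj_sym F b); split; apply: contraNF C => /connect1.
case: (eqVneq x a) => [->|nxa]; last case: (eqVneq x b) => [->|nxb].
- rewrite (negbTE nab) addn0 addn1.
  rewrite (_ : [set y | _] = b |: [set y | adj F a y])%SET; last first.
    apply/setP => y; rewrite !inE adj_cons !xpair_eqE eqxx /= (eq_sym b a) (negbTE nab).
    by rewrite andbF (eq_sym b).
  by rewrite cardsU1 inE Fab.
- rewrite addn0 addn1.
  rewrite (_ : [set y | _] = a |: [set y | adj F b y])%SET; last first.
    apply/setP => y; rewrite !inE adj_cons !xpair_eqE eqxx (negbTE nab) andbT /=.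
    by rewrite (eq_sym a y).
  by rewrite cardsU1 inE Fba.
- by rewrite !addn0; apply: eq_card => y; rewrite !inE adj_cons_neq.
Qed.


Lemma fragments_link_oriented F m a b f g fs :
  fragments F m [:: f, g & fs] -> a \in f -> b \in g -> last a f = a -> head b g = b ->
  joins_fragments F (a, b) ->
  fragments ((a, b) :: F) (link_mate m a b (head a f) (last b g)) ((f ++ g) :: fs).
Proof.
move=> Ffs af bg la hb Fab.
have ufs := fragments_uniq Ffs.
have Ff : fragment F m f by apply: Ffs.2; rewrite mem_head.
have Fg : fragment F m g by apply: Ffs.2; rewrite !inE eqxx orbT.
have fg x : x \in f -> x \notin g.
  by move=> xf; apply: flatten_uniq_disjoint ufs xf (mem_head _ _).
have gf x : x \in g -> x \notin f by move=> xg; apply: contraL xg; apply: fg.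
have neq x y : x \in f -> y \in g -> x != y.
  by move=> xf; apply: contraTneq => <-; apply: fg.
have hf := head_in af; have lg := last_in bg.
split; first by rewrite /= -catA; apply: Ffs.1.
move=> h; rewrite inE => /predU1P[->|hfs].
  have [nf pf cf df mf] := Ff; have [_ pg cg dg mg] := Fg.
  have hE x : head x (f ++ g) = head a f by case: (f) af.
  have lE x : last x (f ++ g) = last b g by rewrite last_cat (last_default _ bg).
  have hfE x : head x f = head a f by rewrite (head_default _ af).
  have lfE x : last x f = a by rewrite (last_default _ af).
  have hgE x : head x g = b by rewrite (head_default _ bg).
  have lgE x : last x g = last b g by rewrite (last_default _ bg).
  have neqS x y : x \in f -> y \in g -> (x == y = false) * (y == x = false).
    by move=> xf yg; rewrite (eq_sym y) !(negbTE (neq _ _ xf yg)).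
  split.
  - by case: (f) nf.
  - case: (f) (g) la hb pf pg nf bg => // z f' [//|y g'] /= la -> pf pg _ _.
    rewrite cat_path (sub_path (@sub_adj_cons _ (a, b) F) pf) /=.
    by rewrite (sub_path (@sub_adj_cons _ (a, b) F) pg) la adj_cons eqxx.
  - move=> x y; rewrite adj_cons !mem_cat => /or3P[/eqP[<- <-]|/eqP[<- <-]|xy].
    + by rewrite af bg orbT.
    + by rewrite af bg orbT.
    + by rewrite (cf _ _ xy) (cg _ _ xy).
  - move=> x; rewrite mem_cat joins_card // hE lE => /orP[xf|xg].
      rewrite df // hfE lfE (neqS x b) // (neqS x (last b g)) //=.
      by case: (x == a); case: (x == _).
    rewrite dg // hgE lgE (neqS a x) // (neqS (head a f) x) //=.
    by case: (x == b); case: (x == _).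
  - move=> x; rewrite mem_cat /link_mate /mate_in hE lE => /orP[xf|xg].
      rewrite mf // /mate_in hfE lfE (neqS x b) // (neqS x (last b g)) //=.
      by case: (x == a); case: (x == _).
    rewrite mg // /mate_in hgE lgE (neqS a x) // (neqS (head a f) x) //=.
    by case: (x == b); case: (x == _).
have [nh ph ch dh mh] : fragment F m h by apply: Ffs.2; rewrite !inE hfs !orbT.
have nfh x : x \in f -> x \notin h.
  by move=> xf; apply: flatten_uniq_disjoint ufs xf _; rewrite inE hfs orbT.
have ngh x : x \in g -> x \notin h.
  move=> xg; move: ufs; rewrite /= cat_uniq => /and3P[_ _ ufs'].
  exact: flatten_uniq_disjoint ufs' xg hfs.
have nE x y : y \notin h -> x \in h -> x == y = false.
  by move=> yh xh; apply: contraNF yh => /eqP<-.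
split=> //.
- by apply: sub_sorted ph; apply: sub_adj_cons.
- move=> x y; rewrite adj_cons => /or3P[/eqP[<- <-]|/eqP[<- <-]|/ch//];
    by rewrite (negbTE (nfh _ af)) (negbTE (ngh _ bg)).
- by move=> x xh; rewrite joins_card // dh // (nE x a) ?(nE x b) ?addn0 //; auto.
- move=> x xh; rewrite -mh // /link_mate.
  by rewrite (nE x a) ?(nE x b) ?(nE x (head a f)) ?(nE x (last b g)) //; auto.
Qed.

Lemma fragments_orient F m f fs a : fragments F m (f :: fs) -> a \in f -> endpoint F a ->
  exists f', [/\ fragments F m (f' :: fs), a \in f' & last a f' = a].
Proof.
move=> Ffs af; rewrite (fragment_endpoint (Ffs.2 _ (mem_head _ _))) // => /orP[]/eqP aE.
  by exists (rev f); split; rewrite ?mem_rev ?last_rev_head //; apply: fragments_rev.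
by exists f.
Qed.

Lemma fragments_link F m fs a b a' b' : fragments F m fs -> joins_fragments F (a, b) ->
  m a = ix a' -> m b = ix b' ->
  exists fs', fragments ((a, b) :: F) (link_mate m a b a' b') fs' /\ size fs = (size fs').+1.
Proof.
move=> Ffs Fab ma mb.
have [f ffs af] := fragments_mem a Ffs; have [g gfs bg] := fragments_mem b Ffs.
have [/= Ea Eb C] := and3P Fab.
have nbf : b \notin f by rewrite -(fragment_connect b (Ffs.2 f ffs) af).
have [fs1 Pfs] : exists fs1, perm_eq fs [:: f, g & fs1].
  exists (rem g (rem f fs)); rewrite (perm_trans (perm_to_rem ffs)) // perm_cons.
  apply: perm_to_rem; move: gfs; rewrite (perm_mem (perm_to_rem ffs)) inE.
  by case/predU1P=> // E; case/negP: nbf; rewrite -E.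
have sfs : size fs = (size fs1).+2 by rewrite (perm_size Pfs).
have {}Ffs := fragments_perm Pfs Ffs.
have mateE h h1 x x' : fragments F m (h :: h1) -> x \in h -> m x = ix x' ->
    last x h = x -> x' = head x h.
  move=> Fh xh mx lx; apply: ix_inj; rewrite -mx.
  have [_ _ _ _ -> //] := Fh.2 h (mem_head _ _).
  by rewrite /mate_in lx eqxx; case: eqP => // <-.
(* Both lists are oriented to end in [a] and in [b]; reversing the second once more makes the merged
   path a concatenation. *)
have [f' [Ff' af' laf]] := fragments_orient Ffs af Ea.
have Pc h1 h2 (h3 : seq (seq S)) : perm_eq [:: h1, h2 & h3] [:: h2, h1 & h3].
  by rewrite -[[:: h1, h2 & h3]]/([:: h1] ++ [:: h2] ++ h3) perm_catCA.
have [g' [Fg' bg' lbg]] := fragments_orient (fragments_perm (Pc _ _ _) Ff') bg Eb.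
have Frg := fragments_perm (Pc _ _ _) (fragments_rev Fg').
exists ((f' ++ rev g') :: fs1); split; last by rewrite sfs.
rewrite (mateE _ _ _ _ (fragments_perm (Pc _ _ _) Fg') af' ma laf).
rewrite (mateE _ _ _ _ Fg' bg' mb lbg) -(last_rev_head b g').
apply: fragments_link_oriented; rewrite ?mem_rev //.
by rewrite head_rev_last.
Qed.

(** One word encodes up to two neighbours: a walk knows the neighbour it comes from, and subtraction
    yields the other. *)
Definition link F x := \sum_(y | adj F x y) ix y.

Lemma link_cons F a b x : joins_fragments F (a, b) ->
  link ((a, b) :: F) x = link F x + (if x == a then ix b else 0) + (if x == b then ix a else 0).
Proof.
case/and3P=> /= _ _ C.
have nab : a != b by apply: contraNneq C => ->.
have [Fab Fba] : adj F a b = false /\ adj F b a = false.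
  by rewrite (adj_sym F b); split; apply: contraNF C => /connect1.
rewrite /link; case: (eqVneq x a) => [->|nxa]; last case: (eqVneq x b) => [->|nxb].
- rewrite (negbTE nab) addn0 (bigD1 b) /=; last by rewrite adj_cons eqxx.
  rewrite addnC; congr (_ + _); apply: eq_bigl => y.
  rewrite adj_cons !xpair_eqE eqxx /= (eq_sym b a) (negbTE nab) andbF /= (eq_sym b y).
  by case: eqP => [->|_]; rewrite ?Fab // andbT.
- rewrite addn0 (bigD1 a) /=; last by rewrite adj_cons eqxx orbT.
  rewrite addnC; congr (_ + _); apply: eq_bigl => y.
  rewrite adj_cons !xpair_eqE eqxx (negbTE nab) andbT /= (eq_sym a y).
  by case: eqP => [->|_]; rewrite ?Fba // andbT.
- by rewrite !addn0; apply: eq_bigl => y; rewrite adj_cons_neq.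
Qed.

Lemma link_nil x : link [::] x = 0.
Proof. by rewrite /link big_pred0. Qed.

(** Degrees are at most 2, so the neighbour sums do not overflow a word. *)
Lemma link_bound F m fs x : fragments F m fs -> link F x <= 2 * #|S|.
Proof.
move=> Ffs; have [f ffs xf] := fragments_mem x Ffs.
have [_ _ _ df _] := Ffs.2 f ffs.
apply: (@leq_trans (\sum_(y | adj F x y) #|S|)); first by apply: leq_sum => y _; apply: ltnW.
rewrite sum_nat_const leq_mul2r; apply/orP; right.
rewrite (_ : #|_| = #|[set y | adj F x y]|); last by apply: eq_card => y; rewrite inE.
by rewrite df //; case: (_ == _); case: (_ == _).
Qed.

(* From [p_i], arriving from [p_(i-1)], the next site has index
   [link F p_i - ix p_(i-1)]. *)
Lemma fragments_walk F m fs r : fragments F m fs -> size fs = 1 -> endpoint F r ->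
  exists p, [/\ perm_eq p (enum S), sorted (adj F) p, nth r p 0 = r &
    forall i, i < #|S| -> link F (nth r p i) =
      (if i is j.+1 then ix (nth r p j) else 0) +
      (if i.+1 < #|S| then ix (nth r p i.+1) else 0)].
Proof.
case: fs => [|f [|//]] // Ffs _ Er.
have rf : r \in f by case: (fragments_mem r Ffs) => g; rewrite inE => /eqP->.
have [f' [Ff' rf' lr]] := fragments_orient Ffs rf Er.
have {Ff'} Fp := fragments_rev Ff'; set p := rev f' in Fp.
have rp : r \in p by rewrite mem_rev.
have hp : head r p = r by rewrite head_rev_last.
have [pp Fpp] := Fp; have [_ sp _ dp _] := Fpp p (mem_head _ _).
move: pp; rewrite /= cats0 => pp.
have sz : size p = #|S| by rewrite (perm_size pp) cardT.
have up : uniq p by rewrite (perm_uniq pp) enum_uniq.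
exists p; split=> //.
move=> i ilt; set x := nth r p i.
have xp : x \in p by rewrite mem_nth ?sz.
have dx := dp x xp.
have -> : link F x = \sum_(y in [set y | adj F x y]) ix y.
  by apply: eq_bigl => y; rewrite inE.
have prevF j : j.+1 = i -> adj F x (nth r p j).
  move=> ji; rewrite adj_sym /x -ji; apply: (elimT (sortedP r) sp); by rewrite ji sz.
have nextF : i.+1 < #|S| -> adj F x (nth r p i.+1).
  by move=> lt; apply: (elimT (sortedP r) sp); rewrite sz.
have n0 : 0 < #|S| by apply: leq_ltn_trans ilt.
have hx : (x != head x p) = (0 < i).
  by rewrite -(head_default r xp) -(nth0 r p) /x nth_uniq ?sz // lt0n.
have lx : (x != last x p) = (i.+1 < #|S|).
  rewrite -(last_default r xp) -[last r p]nth_last sz.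
  rewrite /x nth_uniq ?sz ?prednK //.
  by move: ilt; case: #|S| => // k; rewrite !ltnS ltn_neqAle /= => ->; rewrite andbT.
move: dx; rewrite hx lx => dx {hx lx}.
(* By the degree equation, a set of neighbours of the right size is the whole neighbourhood; it
   remains to exhibit the path neighbours. *)
have NE (A : {set S}) : (forall y, y \in A -> adj F x y) -> #|A| = (0 < i) + (i.+1 < #|S|) ->
    [set y | adj F x y]%SET = A.
  move=> sA cA; apply/eqP; rewrite eq_sym eqEcard dx cA leqnn andbT.
  by apply/fintype.subsetP => y /sA; rewrite inE.
clear dx xp; move: ilt prevF nextF NE; rewrite {}/x; case: i => [|i] ilt prevF nextF NE.
  case: ifP => lt.
    rewrite (NE [set nth r p 1]%SET) ?cards1 ?lt //; first by rewrite big_set1.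
    by move=> y; rewrite inE => /eqP->; apply: nextF.
  rewrite (NE finset.set0) ?cards0 ?lt //; first by rewrite big_set0.
  by move=> y; rewrite inE.
case: ifP => lt.
  have nq : nth r p i != nth r p i.+2.
    rewrite nth_uniq ?sz //; first by lia.
    by apply: ltn_trans ilt.
  rewrite (NE [set nth r p i; nth r p i.+2]%SET) ?cards2 ?nq ?lt //.
    by rewrite big_setU1 ?inE //= big_set1.
  by move=> y; rewrite !inE => /orP[]/eqP->; [apply: prevF|apply: nextF].
rewrite (NE [set nth r p i]%SET) ?cards1 ?lt //; first by rewrite big_set1 addn0.
by move=> y; rewrite inE => /eqP->; apply: prevF.
Qed.

End Fragments.

(** * The program *)

(* Bound on the running time when every loop makes at most [4 * n] rounds. *)
Fixpoint time (n : nat) (P : program) : nat :=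
  match P with
  | Skip => 0
  | Do _ => 1
  | Seq P Q => time n P + time n Q
  | If _ P Q => (maxn (time n P) (time n Q)).+1
  | While _ P => (4 * n * (time n P).+1).+1
  end.

Local Notation "P ;; Q" := (Seq P Q) (at level 61, right associativity).

(* Registers 0-7 hold [n], [0], [1], [2], [2n], [3n], [4n] and [5n]; register 8
   the number of fragments minus one, 9 the height of the stack, and 10 an
   endpoint.  An interior site has mate [n]. *)
Definition initialize : program :=
  Do (Const 2 1) ;; Do (Const 3 2) ;; Do (Defs.Add 4 0 0) ;; Do (Defs.Add 5 4 0) ;;
  Do (Defs.Add 6 5 0) ;; Do (Defs.Add 7 6 0) ;; Do (Defs.Sub 8 0 2) ;;
  While (LtInt 19 0)
    (Do (Defs.Add 20 0 19) ;; Do (Write 20 19) ;; Do (Defs.Add 19 19 2)).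

(** An empty stack is refilled with some live edge at the endpoint in register 10, whatever its
    length. Register 17 receives the other end. *)
Definition start_stack : program :=
  If (EqInt 9 1)
    (Do (Defs.Add 20 0 10) ;; Do (Read 24 20) ;; Do (Const 19 0) ;;
     While (LtInt 19 0)
       (Do (Defs.Add 20 0 19) ;; Do (Read 21 20) ;;
        If (LtInt 21 0)
          (If (EqInt 19 10) Skip (If (EqInt 19 24) Skip (Do (Move 17 19)))) Skip ;;
        Do (Defs.Add 19 19 2)) ;;
     Do (Write 5 10) ;; Do (Write 6 17) ;; Do (Move 9 2))
    Skip.

Definition load_top : program :=
  Do (Defs.Sub 20 9 2) ;; Do (Defs.Add 21 5 20) ;; Do (Read 11 21) ;;
  Do (Defs.Add 21 6 20) ;; Do (Read 12 21) ;;
  Do (Defs.Add 20 0 11) ;; Do (Read 13 20) ;; Do (Defs.Add 20 0 12) ;; Do (Read 14 20) ;;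
  Do (Read 22 11) ;; Do (Read 25 12) ;; Do (GetDist 15 22 25) ;;
  Do (Move 16 11) ;; Do (Move 17 12) ;; Do (Move 18 15).

(** The candidate joins the site indexed by register [p] to the one indexed by register 19;
    registers 16-18 hold the ends and the length of the best edge so far. *)
Definition probe (p mate : nat) : program :=
  Do (Move 23 p) ;; Do (Move 24 mate) ;;
  If (EqInt 19 23) Skip (If (EqInt 19 24) Skip
    (Do (Read 25 23) ;; Do (GetDist 26 25 22) ;;
     If (LeDist 18 26) Skip (Do (Move 16 23) ;; Do (Move 17 19) ;; Do (Move 18 26)))).

(** Four probes per site, because the two fragments at the top have the ends of the top edge and
    their mates as endpoints. *)
Definition scan : program :=
  Do (Const 19 0) ;;
  While (LtInt 19 0)
    (Do (Defs.Add 20 0 19) ;; Do (Read 21 20) ;;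
     If (LtInt 21 0)
       (Do (Read 22 19) ;; probe 11 13 ;; probe 13 11 ;; probe 12 14 ;; probe 14 12)
       Skip ;;
     Do (Defs.Add 19 19 2)).

(** Subtracting 2 from the height drops the top and the entry below it; truncation covers a stack of
    height one. The mate in register 13 is an endpoint of the merged fragment and is kept in
    register 10. *)
Definition merge_top : program :=
  Do (Defs.Add 20 0 11) ;; Do (Write 20 0) ;; Do (Defs.Add 20 0 12) ;; Do (Write 20 0) ;;
  Do (Defs.Add 20 0 13) ;; Do (Write 20 14) ;; Do (Defs.Add 20 0 14) ;; Do (Write 20 13) ;;
  Do (Defs.Add 20 4 11) ;; Do (Read 21 20) ;; Do (Defs.Add 21 21 12) ;; Do (Write 20 21) ;;
  Do (Defs.Add 20 4 12) ;; Do (Read 21 20) ;; Do (Defs.Add 21 21 11) ;; Do (Write 20 21) ;;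
  Do (Move 10 13) ;; Do (Defs.Sub 9 9 3) ;; Do (Defs.Sub 8 8 2).

Definition push_best : program :=
  Do (Defs.Add 20 5 9) ;; Do (Write 20 16) ;; Do (Defs.Add 20 6 9) ;; Do (Write 20 17) ;;
  Do (Defs.Add 9 9 2).

Definition round : program :=
  start_stack ;; load_top ;; scan ;; If (LeDist 15 18) merge_top push_best.

(** The walk is written to a separate array first, since the sites in the first cells are still
    being read. Register 11 starts at 0 because the first site has no predecessor to subtract. *)
Definition write_tour : program :=
  Do (Const 19 0) ;; Do (Const 11 0) ;;
  While (LtInt 19 0)
    (Do (Read 22 10) ;; Do (Defs.Add 20 7 19) ;; Do (Write 20 22) ;;
     Do (Defs.Add 20 4 10) ;; Do (Read 21 20) ;; Do (Defs.Sub 21 21 11) ;;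
     Do (Move 11 10) ;; Do (Move 10 21) ;; Do (Defs.Add 19 19 2)) ;;
  Do (Const 19 0) ;;
  While (LtInt 19 0)
    (Do (Defs.Add 20 7 19) ;; Do (Read 21 20) ;; Do (Write 19 21) ;; Do (Defs.Add 19 19 2)).

Definition multiple_fragment : program :=
  initialize ;; While (LtInt 1 8) round ;; write_tour.

(** * Program verification with running time *)

Section Wp.
Variables (R : realType) (S : finType) (d : S -> S -> R) (w : nat).
Local Notation n := #|S|.
Hypothesis fits : forall k, k < 8 * n + 8 -> k < 2 ^ w.
Local Notation word := (word S R).
Local Notation state := (state S R).
Implicit Types (rf : nat -> word) (mm : nat -> word) (Q : state -> Prop) (st : state).

(** A precondition for total correctness with the time bound built in, so that correctness and
    complexity are proved together. *)
Definition wp P Q st : Prop :=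
  exists k st', [/\ exec d (6 * n) w P st k st', k <= time n P & Q st'].

Lemma wp_conseq P Q Q' st : (forall st', Q st' -> Q' st') -> wp P Q st -> wp P Q' st.
Proof. by move=> QQ' [k [st' [? ? ?]]]; exists k, st'; split=> //; apply: QQ'. Qed.

Lemma wp_skip Q st : Q st -> wp Skip Q st.
Proof. by move=> Qst; exists 0, st; split=> //; constructor. Qed.

Lemma wp_do i Q st st' : run_instr d (6 * n) w i st = Some st' -> Q st' -> wp (Do i) Q st.
Proof. by move=> run Qst; exists 1, st'; split=> //; constructor. Qed.

Lemma wp_seq P1 P2 Q st : wp P1 (wp P2 Q) st -> wp (Seq P1 P2) Q st.
Proof.
move=> [k [st1 [e1 k1 [l [st2 [e2 l1 Qst]]]]]].
by exists (k + l), st2; split=> //=; [apply: ExecSeq e1 e2 | apply: leq_add].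
Qed.

Lemma wp_if c P1 P2 Q st b : run_test c st = Some b ->
  (b -> wp P1 Q st) -> (~~ b -> wp P2 Q st) -> wp (If c P1 P2) Q st.
Proof.
move=> run W1 W2.
have [k [st1 [e1 k1 Qst]]] : wp (if b then P1 else P2) Q st.
  by case: b run W1 W2 => _ W1 W2; auto.
exists k.+1, st1; split=> //=; first exact: ExecIf run e1.
by rewrite ltnS (leq_trans k1) // leq_max; case: b {run W1 W2 e1 k1}; rewrite leqnn ?orbT.
Qed.

(** The index of the invariant is a strictly decreasing bound on the remaining rounds; [4 * n] is
    the count charged by [time]. *)
Lemma wp_while c P (I : nat -> state -> Prop) Q :
  (forall k st, I k st ->
     run_test c st = Some false /\ Q st \/
     run_test c st = Some true /\
       wp P (fun st' => exists2 l, l < k & I l st') st) ->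
  forall k st, k <= 4 * n -> I k st -> wp (While c P) Q st.
Proof.
move=> H k st kn Ik.
suff [t [st' [ex tle Qst]]] : exists t st',
    [/\ exec d (6 * n) w (While c P) st t st', t <= (k * (time n P).+1).+1 & Q st'].
  exists t, st'; split=> //=; apply: leq_trans tle _.
  by rewrite ltnS leq_mul2r kn orbT.
elim/ltn_ind: k st Ik {kn} => k IH st Ik.
have [[run Qst]|[run [t [st1 [e1 t1 [l lk Il]]]]]] := H _ _ Ik.
  by exists 1, st; split=> //; apply: ExecWhileDone.
have [t' [st' [e2 t2 Qst]]] := IH _ lk _ Il.
exists (t + t').+1, st'; split=> //; first exact: ExecWhileStep run e1 e2.
rewrite ltnS (leq_trans (leq_add t1 t2)) //.
by rewrite addnS -addSn -mulSn leq_mul2r lk orbT.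
Qed.

Lemma wp_while_done c P Q st : run_test c st = Some false -> Q st -> wp (While c P) Q st.
Proof. by move=> run Qst; exists 1, st; split=> //; apply: ExecWhileDone. Qed.

Lemma wp_for c b P (J : nat -> state -> Prop) Q st :
  (forall i st, J i st -> reg st c = Int i /\ reg st b = Int n) ->
  (forall i st, i < n -> J i st -> wp P (J i.+1) st) ->
  (forall st, J n st -> Q st) -> J 0 st -> wp (While (LtInt c b) P) Q st.
Proof.
move=> Jr JP JQ J0.
apply: (@wp_while _ _ (fun k st => exists i, k + i = n /\ J i st) _ _ n); last 1 first.
- by exists 0; rewrite addn0.
- move=> k {J0}st [i [kin Ji]]; have [rc rb] := Jr _ _ Ji.
  rewrite /= rc rb; case: ltnP => ni.
    right; split=> //; apply: wp_conseq (JP _ _ ni Ji) => st' J'.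
    have k0 : 0 < k by rewrite -(ltn_add2r i) add0n kin.
    exists k.-1; first by rewrite prednK.
    by exists i.+1; rewrite addnS -addSn prednK.
  by left; split=> //; apply: JQ; have <- // : i = n; apply/eqP; rewrite eqn_leq ni -kin leq_addl.
- exact: leq_pmull.
Qed.

Lemma wp_const r k rf mm Q : k < 8 * n + 8 ->
  Q (State (update rf r (Int k)) mm) -> wp (Do (Const r k)) Q (State rf mm).
Proof. by move=> /fits kw; apply: wp_do; rewrite /= kw. Qed.

Lemma wp_move r a rf mm Q v : rf a = v ->
  Q (State (update rf r v) mm) -> wp (Do (Move r a)) Q (State rf mm).
Proof. by move=> <-; apply: wp_do. Qed.

Lemma wp_add r a b x y rf mm Q : rf a = Int x -> rf b = Int y -> x + y < 8 * n + 8 ->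
  Q (State (update rf r (Int (x + y))) mm) -> wp (Do (Add r a b)) Q (State rf mm).
Proof. by move=> ax bx /fits kw; apply: wp_do; rewrite /= ax bx kw. Qed.

Lemma wp_sub r a b x y rf mm Q : rf a = Int x -> rf b = Int y -> x - y < 8 * n + 8 ->
  Q (State (update rf r (Int (x - y))) mm) -> wp (Do (Defs.Sub r a b)) Q (State rf mm).
Proof. by move=> ax bx /fits kw; apply: wp_do; rewrite /= ax bx kw. Qed.

Lemma wp_getdist r a b x y rf mm Q : rf a = Site x -> rf b = Site y ->
  Q (State (update rf r (Dist (d x y))) mm) -> wp (Do (GetDist r a b)) Q (State rf mm).
Proof. by move=> ax bx; apply: wp_do; rewrite /= ax bx. Qed.

(* The memory is divided into six arrays of length [n]: the sites, their mates (the
   other endpoints of their fragments), the sums of the indices of their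
   neighbours, the first and second ends of the edges on the stack, and the tour. *)
Definition arrays (G : nat -> nat -> word) : nat -> word := fun a => G (a %/ n) (a %% n).

Definition store (G : nat -> nat -> word) j i v : nat -> nat -> word :=
  fun j' i' => if (j' == j) && (i' == i) then v else G j' i'.

Lemma arraysE G j i : i < n -> arrays G (j * n + i) = G j i.
Proof.
move=> lt; have n0 := leq_ltn_trans (leq0n i) lt.
by rewrite /arrays divnMDl // divn_small // addn0 modnMDl modn_small.
Qed.

Lemma arrays_store G j i v : i < n ->
  update (arrays G) (j * n + i) v = arrays (store G j i v).
Proof.
move=> lt; have n0 := leq_ltn_trans (leq0n i) lt.
apply/funext => a; rewrite /update {2}/arrays /store.
have -> : (a == j * n + i) = (a %/ n == j) && (a %% n == i).
  apply/eqP/andP => [->|[/eqP<- /eqP<-]]; last exact: divn_eq.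
  by rewrite divnMDl // divn_small // addn0 modnMDl modn_small.
by case: ifP.
Qed.

Lemma in_arrays j i : j < 6 -> i < n -> j * n + i < 6 * n.
Proof.
move=> j6 lt; apply: (@leq_trans (j.+1 * n)); first by rewrite mulSnr ltn_add2l.
by rewrite leq_mul2r j6 orbT.
Qed.

Lemma wp_read r a x j i v rf G Q : rf a = Int x -> x = j * n + i -> j < 6 -> i < n ->
  G j i = v ->
  Q (State (update rf r v) (arrays G)) -> wp (Do (Read r a)) Q (State rf (arrays G)).
Proof.
move=> + E j6 lt <- Qs; rewrite {x}E => ax; apply: wp_do Qs; rewrite /= ax.
by rewrite arraysE // in_arrays.
Qed.

Lemma wp_write a b x j i v rf G Q : rf a = Int x -> rf b = v -> x = j * n + i ->
  j < 6 -> i < n ->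
  Q (State rf (arrays (store G j i v))) -> wp (Do (Write a b)) Q (State rf (arrays G)).
Proof.
move=> + bv E j6 lt Qs; rewrite {x}E => ax; apply: wp_do Qs; rewrite /= ax bv.
by rewrite arrays_store // in_arrays.
Qed.


Ltac look := solve [reflexivity | eassumption | rewrite /update /=; first [eassumption | reflexivity]].
Ltac wadd := try eapply wp_seq; eapply wp_add; [look | look | try solve [clear; lia] | cbv beta].
Ltac wsub := try eapply wp_seq; eapply wp_sub; [look | look | try solve [clear; lia] | cbv beta].
Ltac wmove := try eapply wp_seq; eapply wp_move; [look | cbv beta].
Ltac wconst := try eapply wp_seq; eapply wp_const; [try solve [clear; lia] | cbv beta].
Ltac wread j0 i0 v0 := try eapply wp_seq; eapply wp_read with (j := j0) (i := i0) (v := v0);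
  [look | try solve [clear; lia] | done | try done | try by rewrite /store /= | cbv beta].
Ltac wwrite j0 i0 v0 := try eapply wp_seq; eapply wp_write with (j := j0) (i := i0) (v := v0);
  [look | look | try solve [clear; lia] | done | try done | cbv beta].

Variable ix : S -> nat.
Hypotheses (ix_inj : injective ix) (ix_lt : forall x, ix x < n).
Hypothesis ix_surj : forall i, i < n -> exists x, ix x = i.
Hypothesis d_sym : forall x y, d x y = d y x.
Implicit Types (G : nat -> nat -> word) (F s : seq (S * S)) (m : S -> nat) (e b : S * S).

Lemma fits_index x c : c <= 6 -> c * n + ix x < 8 * n + 8.
Proof.
move=> c6; rewrite ltn_addr // (leq_trans (n := c.+1 * n)) //.
  by rewrite mulSnr ltn_add2l.
by rewrite leq_mul2r ltnS (leq_trans c6) ?orbT.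
Qed.

Lemma fits_next x : ix x + 1 < 8 * n + 8.
Proof.
by rewrite addn1 -(addn1 (ix x)) (leq_trans _ (leq_addr _ _)) //; have := ix_lt x; lia.
Qed.

(** A scan writes only registers from 16 on, so the data of the round, kept below 16, survive it. *)
Lemma update16 rf k v i : 16 <= k -> i < 16 -> update rf k v i = rf i.
Proof. by move=> k16 i16; rewrite /update ifF //; apply/negbTE; rewrite neq_ltn (leq_trans i16). Qed.

(** * Probing and scanning near the top of the stack *)

Definition best rf b : Prop :=
  [/\ rf 16 = Int (ix b.1), rf 17 = Int (ix b.2) & rf 18 = Dist (len d b)].

(** Liveness of the candidate is left to the caller, who supplies the mate of [p] for [k] and knows
    that [y] is an endpoint. *)
Lemma wp_probe pr pmr p y k b rf G Q :
  (forall x, G 0 (ix x) = Site x) -> pr < 16 -> pmr < 16 ->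
  rf pr = Int (ix p) -> rf pmr = Int k -> rf 19 = Int (ix y) -> rf 22 = Site y ->
  best rf b ->
  (forall rf' b', (forall i, i < 16 -> rf' i = rf i) -> rf' 19 = Int (ix y) ->
     rf' 22 = Site y -> best rf' b' ->
     b' = b \/ [/\ b' = (p, y), y != p & ix y != k] ->
     (len d b' <= len d b)%R ->
     (y != p -> ix y != k -> (len d b' <= d p y)%R) -> Q (State rf' (arrays G))) ->
  wp (probe pr pmr) Q (State rf (arrays G)).
Proof.
move=> HG pr16 pmr16 Hp Hk Hy Hsy [B1 B2 B3] HQ.
have B0 rf' : (forall i, 15 < i < 19 -> rf' i = rf i) -> best rf' b by move=> E; split; rewrite E.
wmove; wmove.
apply: (wp_if (b := ix y == ix p)).
- rewrite /= /update /=.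
  by rewrite Hy Hp.
- move=> /eqP/ix_inj yp; apply: wp_skip; apply: (HQ _ b) => //.
  + by move=> i i16; rewrite !update16.
  + by left.
  + by rewrite yp eqxx.
rewrite (inj_eq ix_inj) => nyp.
apply: (wp_if (b := ix y == k)).
- rewrite /= /update /= Hy ifF ?Hk //.
  by apply/negbTE; rewrite neq_ltn (leq_trans pmr16).
- move=> yk; apply: wp_skip; apply: (HQ _ b) => //.
  + by move=> i i16; rewrite !update16.
  + by left.
  + by rewrite yk.
move=> nyk.
wread 0 (ix p) (Site p : word).
eapply wp_seq; eapply wp_getdist; [look | look | cbv beta].
apply: (wp_if (b := (len d b <= d p y)%R)).
- by rewrite /= /update /= B3.
- move=> le; apply: wp_skip; apply: (HQ _ b) => //.
  + by move=> i i16; rewrite !update16.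
  + by left.
rewrite -ltNge => lt.
wmove; wmove; wmove.
apply: (HQ _ (p, y)) => //.
- by move=> i i16; rewrite !update16.
- by right; split.
- exact: ltW.
Qed.


Lemma joinsC F x y : joins_fragments F (x, y) = joins_fragments F (y, x).
Proof. by rewrite /joins_fragments /= (adj_connect_sym F x) andbCA. Qed.

(** A live edge near [e] has an end in a fragment of [e]. That end is an endpoint, hence one of the
    four listed sites; symmetry of [d] allows it to be either end of the edge. *)
Lemma min_nearby_mates F m fs e l u' v' : fragments ix F m fs ->
  m e.1 = ix u' -> m e.2 = ix v' -> joins_fragments F e ->
  (forall p y, p \in [:: e.1; u'; e.2; v'] -> endpoint F y -> y != p -> ix y != m p ->
     (l <= d p y)%R) ->
  min_nearby d F e l.
Proof.
move=> Ffs mu mv /and3P[Eu Ev _] H [x1 x2] Fx tx.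
have mates p p' z : endpoint F p -> m p = ix p' -> endpoint F z -> connect (adj F) p z ->
    z = p \/ z = p'.
  move=> Ep mp Ez cz; have [p2 [mp2 _ _ _ all]] := fragments_mate Ffs Ep.
  by have <- : p2 = p'; [apply: ix_inj; rewrite -mp2 | apply: all].
have near z1 z2 : joins_fragments F (z1, z2) ->
    connect (adj F) e.1 z1 || connect (adj F) e.2 z1 -> (l <= d z1 z2)%R.
  move=> Fz; have [/= E1 E2 _] := and3P Fz.
  move: Fz; rewrite (fragments_joins ix_inj Ffs) // => /andP[n1 n2] cz.
  apply: H => //; rewrite !inE.
  by case/orP: cz => [/(mates _ _ _ Eu mu E1)|/(mates _ _ _ Ev mv E1)] [] ->;
    rewrite eqxx ?orbT.
rewrite /len /=; case/or4P: tx => /= c.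
- by apply: near; rewrite ?c.
- by rewrite d_sym; apply: near; rewrite 1?joinsC ?c.
- by apply: near; rewrite ?c ?orbT.
- by rewrite d_sym; apply: near; rewrite 1?joinsC ?c ?orbT.
Qed.

Lemma wp_scan F m fs e u' v' rf G Q :
  (forall x, G 0 (ix x) = Site x) -> (forall x, G 1 (ix x) = Int (m x)) ->
  fragments ix F m fs -> joins_fragments F e -> m e.1 = ix u' -> m e.2 = ix v' ->
  rf 0 = Int n -> rf 2 = Int 1 -> rf 11 = Int (ix e.1) -> rf 12 = Int (ix e.2) ->
  rf 13 = Int (ix u') -> rf 14 = Int (ix v') -> best rf e ->
  (forall rf' b, (forall i, i < 16 -> rf' i = rf i) -> best rf' b ->
     joins_fragments F b -> (len d b <= len d e)%R -> min_nearby d F e (len d b) ->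
     Q (State rf' (arrays G))) ->
  wp scan Q (State rf (arrays G)).
Proof.
move=> G0 G1 Ffs Fe mu mv R0 R2 R11 R12 R13 R14 Be HQ.
have [Eu Ev _] := and3P Fe.
have mateP p p' : endpoint F p -> m p = ix p' -> endpoint F p' /\ m p' = ix p.
  move=> Ep mp; have [p2 [mp2 ? _ mp2' _]] := fragments_mate Ffs Ep.
  by have <- : p2 = p' by apply: ix_inj; rewrite -mp2.
have [Eu' mu'] := mateP _ _ Eu mu; have [Ev' mv'] := mateP _ _ Ev mv.
wconst.
(* The best edge is live and no longer than any live edge from one of the four endpoints to a site
   of index below [i]; starting with [e] gives the bound by [len d e]. *)
pose J i st := exists rf' b, [/\ st = State rf' (arrays G),
  forall k, k < 16 -> rf' k = rf k, rf' 19 = Int i &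
  [/\ best rf' b, joins_fragments F b, (len d b <= len d e)%R &
   forall p y, p \in [:: e.1; u'; e.2; v'] -> ix y < i -> endpoint F y ->
     y != p -> ix y != m p -> (len d b <= d p y)%R]].
apply: (wp_for (J := J)).
- by move=> i st [rf' [b [-> fr R19 _]]] /=; rewrite (fr 0).
- move=> i st ltin [rf' [b [-> fr R19 [Bb Fb leb Hb]]]].
  have [y yi] := ix_surj ltin; rewrite -{}yi in R19 Hb *.
  have {}R0 : rf' 0 = Int n by rewrite fr.
  have {}R2 : rf' 2 = Int 1 by rewrite fr.
  wadd; first by rewrite -[X in X + _]mul1n; apply: fits_index.
  wread 1 (ix y) (Int (m y) : word).
  eapply wp_seq.
  apply: (wp_if (b := m y < n)).
  + by rewrite /= /update /= R0.
  + rewrite (fragments_endpoint ix_lt _ Ffs) => Ey.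
    have joinP p b1 b2 : endpoint F p -> joins_fragments F b1 ->
        b2 = b1 \/ [/\ b2 = (p, y), y != p & ix y != m p] -> joins_fragments F b2.
      move=> Ep Fb1 [->//|[-> n1 n2]].
      by rewrite (fragments_joins ix_inj Ffs) // n1.
    wread 0 (ix y) (Site y : word).
    eapply wp_seq; eapply (wp_probe (p := e.1) (y := y) (k := m e.1)) => //; try look.
    * by rewrite /update /= fr.
    * by rewrite /update /= fr // R13 mu.
    move=> rf1 b1 fr1 A1 A2 B1 /(joinP _ _ _ Eu Fb) F1 l1 H1.
    eapply wp_seq; eapply (wp_probe (p := u') (y := y) (k := m u')) => //; try look.
    * by rewrite fr1 // /update /= fr.
    * by rewrite fr1 // /update /= fr // R11 mu'.
    move=> rf2 b2 fr2 {}A1 {}A2 {}B1 /(joinP _ _ _ Eu' F1) F2 l2 H2.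
    eapply wp_seq; eapply (wp_probe (p := e.2) (y := y) (k := m e.2)) => //; try look.
    * by rewrite fr2 // fr1 // /update /= fr.
    * by rewrite fr2 // fr1 // /update /= fr // R14 mv.
    move=> rf3 b3 fr3 {}A1 {}A2 {}B1 /(joinP _ _ _ Ev F2) F3 l3 H3.
    eapply (wp_probe (p := v') (y := y) (k := m v')) => //; try look.
    * by rewrite fr3 // fr2 // fr1 // /update /= fr.
    * by rewrite fr3 // fr2 // fr1 // /update /= fr // R12 mv'.
    move=> rf4 b4 fr4 {}A1 {}A2 B4 /(joinP _ _ _ Ev' F3) F4 l4 H4.
    have fr' k : k < 16 -> rf4 k = rf' k.
      by move=> k16; rewrite fr4 // fr3 // fr2 // fr1 // !update16.
    eapply wp_add; [look | rewrite fr' //; exact: R2 | | cbv beta].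
      exact: fits_next.
    exists (update rf4 19 (Int (ix y + 1))), b4; split=> //.
    * by move=> k k16; rewrite update16 // fr' // fr.
    * by rewrite /update /= addn1.
    split=> //.
    * apply: le_trans leb; apply: le_trans l1; apply: le_trans l2.
      exact: le_trans l4 l3.
    (* For the site just scanned, the bound comes from the probe at [p] and the later improvements;
       for earlier sites, from the invariant. *)
    move=> p z pin; rewrite ltnS leq_eqVlt => /predU1P[/ix_inj->|zy] Ez nzp nzm.
      move: pin nzp nzm; rewrite !inE => /or4P[]/eqP-> nzp nzm.
      + apply: le_trans (H1 nzp nzm); apply: le_trans l2; exact: le_trans l4 l3.
      + apply: le_trans (H2 nzp nzm); exact: le_trans l4 l3.
      + exact: le_trans l4 (H3 nzp nzm).
      + exact: H4.
    apply: le_trans (Hb p z pin zy Ez nzp nzm).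
    by apply: le_trans l1; apply: le_trans l2; exact: le_trans l4 l3.
  + rewrite (fragments_endpoint ix_lt _ Ffs) => nEy; apply: wp_skip.
    wadd.
      exact: fits_next.
    exists (update (update (update rf' 20 (Int (n + ix y))) 21 (Int (m y))) 19 (Int (ix y + 1))), b.
    split=> //.
    * by move=> k k16; rewrite !update16 // fr.
    * by rewrite /update /= addn1.
    split=> //.
    move=> p z pin; rewrite ltnS leq_eqVlt => /predU1P[/ix_inj->|zy] Ez; last exact: Hb.
    by rewrite Ez in nEy.
- move=> st [rf' [b [-> fr R19 [Bb Fb leb Hb]]]].
  apply: (HQ _ b) => //.
  by apply: min_nearby_mates Ffs mu mv Fe _ => p y pin Ey n1 n2; apply: Hb.
- exists (update rf 19 (Int 0)), e; split=> //.
  by move=> k k16; rewrite !update16.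
Qed.


(** * The loop invariant and one round *)

Definition base rf : Prop :=
  [/\ rf 0 = Int n, rf 1 = Int 0, rf 2 = Int 1, rf 3 = Int 2 &
   [/\ rf 4 = Int (2 * n), rf 5 = Int (3 * n), rf 6 = Int (4 * n) & rf 7 = Int (5 * n)]].

Lemma base_frame rf rf' : (forall k, k < 8 -> rf' k = rf k) -> base rf -> base rf'.
Proof. by move=> fr [? ? ? ? [? ? ? ?]]; do 2![split; rewrite ?fr //]. Qed.

(** The top is at the head of the list but at the highest position in memory, so a push leaves the
    stored entries in place. *)
Fixpoint stored_stack G s : Prop :=
  if s is e :: s' then
    [/\ G 3 (size s') = Int (ix e.1), G 4 (size s') = Int (ix e.2) & stored_stack G s']
  else True.

Lemma stored_stack_ext G G' s :
  (forall i, i < size s -> G' 3 i = G 3 i /\ G' 4 i = G 4 i) ->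
  stored_stack G s -> stored_stack G' s.
Proof.
elim: s => //= e s IH E [E1 E2 Es]; have [E3 E4] := E _ (leqnn _).
by rewrite E3 E4; split=> //; apply: IH => // i lt; apply: E; apply: ltnW.
Qed.

Definition stored G F m s : Prop :=
  [/\ forall x, G 0 (ix x) = Site x, forall x, G 1 (ix x) = Int (m x),
      forall x, G 2 (ix x) = Int (link ix F x) & stored_stack G s].

(** The site [r] remains an endpoint so that an empty stack can be refilled from it. The lists [fs]
    exist only in the proof; the machine stores their number minus one. *)
Definition invariant F s fs r m rf G : Prop :=
  [/\ base rf, [/\ rf 8 = Int (size fs).-1, rf 9 = Int (size s) & rf 10 = Int (ix r)],
      stored G F m s, fragments ix F m fs &
      [/\ good d F, descending d F s & endpoint F r]].

(** The head of any fragment that avoids [r] serves as [q]. *)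
Lemma joins_exists F m fs r : fragments ix F m fs -> 1 < size fs -> endpoint F r ->
  exists q, joins_fragments F (r, q).
Proof.
move=> Ffs sz Er.
have [g gfs rg] : exists2 g, g \in fs & r \notin g.
  case: fs Ffs sz => [|f [|g fs]] // Ffs _.
  case: (boolP (r \in f)) => rf; last by exists f; rewrite ?mem_head.
  exists g; first by rewrite !inE eqxx orbT.
  by apply: flatten_uniq_disjoint (fragments_uniq Ffs) rf (mem_head _ _).
have Fg := Ffs.2 g gfs; have [ng _ _ _ _] := Fg.
case: g {gfs} ng rg Fg => // q g _ rg Fg; exists q.
have qg : q \in q :: g by rewrite mem_head.
rewrite /joins_fragments /= Er (fragment_endpoint Fg) //= eqxx /=.
by rewrite adj_connect_sym (fragment_connect _ Fg).
Qed.

Lemma wp_start F s fs r m rf G Q : invariant F s fs r m rf G -> 1 < size fs ->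
  (forall rf' G' e s', invariant F (e :: s') fs r m rf' G' ->
     s = e :: s' \/ s = [::] /\ s' = [::] -> Q (State rf' (arrays G'))) ->
  wp start_stack Q (State rf (arrays G)).
Proof.
move=> inv sz HQ; have [B [R8 R9 R10] [G0 G1 G2 Gs] Ffs [gF ds Er]] := inv.
have [R0 R1 R2 R3 [R4 R5 R6 R7]] := B.
have n0 : 0 < n by apply: leq_ltn_trans (ix_lt r).
apply: (wp_if (b := size s == 0)); first by rewrite /= R9 R1.
  move=> /eqP/size0nil s0; rewrite {}s0 {s} in inv R9 Gs ds HQ.
  wadd; first by rewrite -[X in X + _]mul1n; apply: fits_index.
  wread 1 (ix r) (Int (m r) : word).
  wconst.
  (* Either a live edge at [r] has been found, or all of them lead to sites not yet scanned; at the
     end [joins_exists] rules out the second case. *)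
  pose J i st := exists rf', [/\ st = State rf' (arrays G),
    forall k, k < 16 -> rf' k = rf k, rf' 19 = Int i, rf' 24 = Int (m r) &
    (exists2 q, joins_fragments F (r, q) & rf' 17 = Int (ix q)) \/
    (forall q, joins_fragments F (r, q) -> i <= ix q)].
  eapply wp_seq; apply: (wp_for (J := J)).
  - by move=> i st [rf' [-> fr R19 _ _]] /=; rewrite (fr 0).
  - move=> i st ltin [rf' [-> fr R19 R24 alt]].
    have [y yi] := ix_surj ltin; rewrite -{}yi in R19 alt *.
    have {}R0 : rf' 0 = Int n by rewrite fr.
    have {}R2 : rf' 2 = Int 1 by rewrite fr.
    have {}R10 : rf' 10 = Int (ix r) by rewrite fr.
    wadd; first by rewrite -[X in X + _]mul1n; apply: fits_index.
    wread 1 (ix y) (Int (m y) : word).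
    (* The three branches that leave register 17 alone share this argument. *)
    have skip rf2 : (forall k, k < 20 -> rf2 k = rf' k) -> rf2 24 = rf' 24 ->
        ~~ joins_fragments F (r, y) -> wp (Do (Defs.Add 19 19 2)) (J (ix y).+1) (State rf2 (arrays G)).
      move=> fr2 E24 nFy.
      eapply wp_add; [by rewrite fr2 // R19 | by rewrite fr2 // R2 | exact: fits_next | cbv beta].
      exists (update rf2 19 (Int (ix y + 1))); split=> //.
      + by move=> k k16; rewrite update16 // fr2 ?fr // (leq_trans k16).
      + by rewrite /update /= addn1.
      + by rewrite /update /= E24.
      + case: alt => [[q Fq R17]|alt]; [left|right].
          by exists q => //; rewrite /update /= fr2.
        move=> q Fq; rewrite ltn_neqAle alt // andbT (inj_eq ix_inj).
        by apply: contraNneq nFy => ->.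
    eapply wp_seq.
    apply: (wp_if (b := m y < n)); first by rewrite /= /update /= R0.
      rewrite (fragments_endpoint ix_lt _ Ffs) => Ey.
      apply: (wp_if (b := ix y == ix r)); first by rewrite /= /update /= R19 R10.
        rewrite (inj_eq ix_inj) => yr; apply: wp_skip; apply: skip => //.
        + by do 20 case=> //.
        + by rewrite (fragments_joins ix_inj Ffs) // yr.
      rewrite (inj_eq ix_inj) => nyr.
      apply: (wp_if (b := ix y == m r)); first by rewrite /= /update /= R19 R24.
        move=> ym; apply: wp_skip; apply: skip => //.
        + by do 20 case=> //.
        + by rewrite (fragments_joins ix_inj Ffs) // ym andbF.
      move=> nym.
      wmove.
      wadd; first exact: fits_next.
      eexists; split; first by [].
      + by move=> k k16; rewrite !update16 ?fr // /update /=; do 17 case: k k16 => // k k16.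
      + by rewrite /update /= addn1.
      + by rewrite /update /=.
      + left; exists y; last by rewrite /update /= R19.
        by rewrite (fragments_joins ix_inj Ffs) // nyr.
    rewrite (fragments_endpoint ix_lt _ Ffs) => nEy; apply: wp_skip; apply: skip => //.
    + by do 20 case=> //.
    + by apply: contra nEy; case/and3P.
  - move=> st [rf' [-> fr R19 R24 alt]].
    have [q Fq R17] : exists2 q, joins_fragments F (r, q) & rf' 17 = Int (ix q).
      case: alt => // alt; have [q Fq] := joins_exists Ffs sz Er.
      by have := alt q Fq; rewrite leqNgt ix_lt.
    have {}R2 : rf' 2 = Int 1 by rewrite fr.
    have {}R5 : rf' 5 = Int (3 * n) by rewrite fr.
    have {}R6 : rf' 6 = Int (4 * n) by rewrite fr.
    have {}R10 : rf' 10 = Int (ix r) by rewrite fr.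
    wwrite 3 0 (Int (ix r) : word).
    wwrite 4 0 (Int (ix q) : word).
    wmove.
    apply: (HQ _ _ (r, q) [::]); last by right.
    split=> //.
    + by apply: base_frame B => k k8; rewrite /update ifF ?fr //; do 8 case: k k8 => // k k8.
    + by split; rewrite /update /= ?R2 ?R10 // fr.
  - by eexists; split; first by []; [move=> k k16; rewrite !update16 | | |right].
rewrite -lt0n => s0; apply: wp_skip.
case: s inv s0 HQ {R9 Gs ds} => // e s inv _ HQ.
by apply: HQ inv _; left.
Qed.


Lemma wp_load F e s fs r m rf G Q : invariant F (e :: s) fs r m rf G ->
  (forall rf' u' v', (forall k, k < 11 -> rf' k = rf k) ->
     rf' 11 = Int (ix e.1) -> rf' 12 = Int (ix e.2) -> rf' 13 = Int (ix u') ->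
     rf' 14 = Int (ix v') -> rf' 15 = Dist (len d e) -> best rf' e ->
     m e.1 = ix u' -> m e.2 = ix v' -> Q (State rf' (arrays G))) ->
  wp load_top Q (State rf (arrays G)).
Proof.
move=> inv HQ; have [B [R8 R9 R10] [G0 G1 G2 [Ge1 Ge2 _]] Ffs [gF ds Er]] := inv.
have [R0 R1 R2 R3 [R4 R5 R6 R7]] := B.
have {}R9 : rf 9 = Int (size s).+1 := R9.
have szs : size s < n := descending_size ds.
have [/and3P[Eu Ev _] _ _ _] := ds.
have [u' [mu _ _ _ _]] := fragments_mate Ffs Eu.
have [v' [mv _ _ _ _]] := fragments_mate Ffs Ev.
have small c : c <= 6 -> c * n + (size s).+1 < 8 * n + 8.
  move=> c6; have: c * n <= 6 * n by rewrite leq_mul2r c6 orbT.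
  by clear -szs; lia.
wsub; first by apply: leq_ltn_trans (small 0 isT); rewrite leq_subr.
wadd.
  by apply: leq_ltn_trans (small 3 isT); rewrite leq_add2l leq_subr.
wread 3 (size s) (Int (ix e.1) : word).
wadd.
  by apply: leq_ltn_trans (small 4 isT); rewrite leq_add2l leq_subr.
wread 4 (size s) (Int (ix e.2) : word).
wadd; first by rewrite -[X in X + _]mul1n; apply: fits_index.
wread 1 (ix e.1) (Int (ix u') : word); first by rewrite G1 mu.
wadd; first by rewrite -[X in X + _]mul1n; apply: fits_index.
wread 1 (ix e.2) (Int (ix v') : word); first by rewrite G1 mv.
wread 0 (ix e.1) (Site e.1 : word).
wread 0 (ix e.2) (Site e.2 : word).
eapply wp_seq; eapply wp_getdist; [look | look | cbv beta].
wmove; wmove; wmove.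
apply: HQ mu mv => //.
move=> i i11; rewrite /update; do 11 case: i i11 => // i i11.
Qed.

Lemma wp_push F e b s fs r m rf0 rf G Q : invariant F (e :: s) fs r m rf0 G ->
  (forall k, k < 11 -> rf k = rf0 k) -> best rf b ->
  joins_fragments F b -> (len d b < len d e)%R -> min_nearby d F e (len d b) ->
  (forall rf' G', invariant F [:: b, e & s] fs r m rf' G' -> Q (State rf' (arrays G'))) ->
  wp push_best Q (State rf (arrays G)).
Proof.
move=> inv fr [B1 B2 B3] Fb lt mb HQ.
have [B [R8 R9 R10] [G0 G1 G2 Gs] Ffs [gF ds Er]] := inv.
have {}B : base rf by apply: base_frame B => k k8; rewrite fr // (leq_trans k8).
have [R0 R1 R2 R3 [R4 R5 R6 R7]] := B.
(* The longer stack is descending before it is stored, so its height is at most [n] and the new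
   entry fits the arrays. *)
have ds' := descending_push ds Fb mb lt.
have szs : (size s).+1 < n := descending_size ds'.
have {}R8 : rf 8 = Int (size fs).-1 by rewrite fr.
have {}R9 : rf 9 = Int (size s).+1 by rewrite fr.
have {}R10 : rf 10 = Int (ix r) by rewrite fr.
have [z zE] := ix_surj szs.
wadd; first by rewrite -zE; apply: fits_index.
wwrite 3 (size s).+1 (Int (ix b.1) : word).
wadd; first by rewrite -zE; apply: fits_index.
wwrite 4 (size s).+1 (Int (ix b.2) : word).
wadd; first by rewrite -zE; apply: fits_next.
apply: HQ; split=> //.
- by split; rewrite /update /= ?addn1.
split=> //; split; try by rewrite /store /= eqxx.
apply: stored_stack_ext Gs => i lti.
by rewrite /store /= ltn_eqF.
Qed.

Lemma wp_merge F e s fs r m rf0 rf u' v' G Q : invariant F (e :: s) fs r m rf0 G ->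
  (forall k, k < 11 -> rf k = rf0 k) ->
  rf 11 = Int (ix e.1) -> rf 12 = Int (ix e.2) -> rf 13 = Int (ix u') ->
  rf 14 = Int (ix v') -> m e.1 = ix u' -> m e.2 = ix v' ->
  min_nearby d F e (len d e) ->
  (forall rf' G' fs' m', invariant (e :: F) (behead s) fs' u' m' rf' G' ->
     size fs = (size fs').+1 -> Q (State rf' (arrays G'))) ->
  wp merge_top Q (State rf (arrays G)).
Proof.
case: e => a b /= inv fr R11 R12 R13 R14 ma mb me HQ.
have [B [R8 R9 R10] [G0 G1 G2 [_ _ Gs]] Ffs [gF ds Er]] := inv.
have {}B : base rf by apply: base_frame B => k k8; rewrite fr // (leq_trans k8).
have [R0 R1 R2 R3 [R4 R5 R6 R7]] := B.
have {}R8 : rf 8 = Int (size fs).-1 by rewrite fr.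
have {}R9 : rf 9 = Int (size s).+1 by rewrite fr.
have szs : size s < n := descending_size ds.
have [Fab _ _ _] := ds.
have [fs' [Ffs' szf]] := fragments_link ix_inj Ffs Fab ma mb.
have nab : a != b.
  by case/and3P: Fab => _ _; apply: contraNneq => /= ->; apply: connect0.
have small x y : link ix F x + ix y < 8 * n + 8.
  rewrite (leq_ltn_trans (n := 2 * n + ix y)) ?fits_index // leq_add2r.
  exact: link_bound Ffs.
wadd; first by rewrite -[X in X + _]mul1n; apply: fits_index.
wwrite 1 (ix a) (Int n : word).
wadd; first by rewrite -[X in X + _]mul1n; apply: fits_index.
wwrite 1 (ix b) (Int n : word).
wadd; first by rewrite -[X in X + _]mul1n; apply: fits_index.
wwrite 1 (ix u') (Int (ix v') : word).
wadd; first by rewrite -[X in X + _]mul1n; apply: fits_index.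
wwrite 1 (ix v') (Int (ix u') : word).
wadd; first exact: fits_index.
wread 2 (ix a) (Int (link ix F a) : word).
wadd; first exact: small.
wwrite 2 (ix a) (Int (link ix F a + ix b) : word).
wadd; first exact: fits_index.
wread 2 (ix b) (Int (link ix F b) : word).
  by rewrite /store /= (inj_eq ix_inj) eq_sym (negbTE nab).
wadd; first exact: small.
wwrite 2 (ix b) (Int (link ix F b + ix a) : word).
wmove.
wsub; first by clear -szs; lia.
wsub.
  by have := fragments_size Ffs; clear; lia.
apply: (HQ _ _ fs' (link_mate ix m a b u' v')) => //; split=> //.
- split; rewrite /update /=.
  + by rewrite szf subn1.
  + by rewrite size_behead subSS subn1.
  + by [].
- split=> //.
  + by move=> x; rewrite /store /= !(inj_eq ix_inj) /link_mate; do 4!case: ifP => // _.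
  + move=> x; rewrite /store /= !(inj_eq ix_inj) link_cons //.
    case: (eqVneq x a) => [->|_]; first by rewrite (negbTE nab) addn0.
    by case: eqP => [->|_]; rewrite ?addn0.
  + case: (s) Gs => [|c s1] //= [_ _ Gs]; apply: stored_stack_ext Gs => i lti.
    by [].
split=> //.
- exact: descending_merge ds.
(* The new mate of [u'] is the index of a site, hence below [#|S|], which marks [u'] as an
   endpoint. *)
- rewrite -(fragments_endpoint ix_lt _ Ffs') /link_mate.
  by case: ifP => _; rewrite ?eqxx.
Qed.

(* A push lengthens the stack by one; a merge removes one fragment and at most two
   entries of the stack. *)
Definition measure (s : seq (S * S)) (fs : seq (seq S)) := 3 * (size fs).-1 + (n - size s).

Lemma wp_round F s fs r m rf G : invariant F s fs r m rf G -> 1 < size fs ->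
  wp round (fun st => exists F' s' fs' r' m' rf' G',
    [/\ st = State rf' (arrays G'), invariant F' s' fs' r' m' rf' G' &
        measure s' fs' < measure s fs]) (State rf (arrays G)).
Proof.
move=> inv sz; apply: wp_seq; apply: (wp_start inv sz) => {inv}{}rf {}G e s' inv sE.
have [_ _ _ _ [_ ds _]] := inv.
have szs : size s' < n := descending_size ds.
apply: wp_seq; apply: (wp_load inv) => rf1 u' v' fr1 R11 R12 R13 R14 R15 B1 mu mv.
have [B _ [G0 G1 _ _] Ffs _] := inv; have [R0 _ R2 _ _] := B.
have [Fe _ _ _] := ds.
apply: wp_seq; apply: (wp_scan G0 G1 Ffs Fe mu mv) => //; try by rewrite fr1.
move=> rf2 b fr2 Bb Fb le mb.
apply: (wp_if (b := (len d e <= len d b)%R)).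
- by rewrite /= fr2 // R15; case: Bb => _ _ ->.
- move=> le'; apply: (wp_merge inv (u' := u') (v' := v')) => //.
  + by move=> k k11; rewrite fr2 ?fr1 // (leq_trans k11).
  + by rewrite fr2.
  + by rewrite fr2.
  + by rewrite fr2.
  + by rewrite fr2.
  + by move=> x Fx tx; apply: le_trans le' (mb x Fx tx).
  move=> rf' G' fs' m' inv' szf.
  exists (e :: F), (behead s'), fs', u', m', rf', G'; split=> //.
  have fs0 : 0 < size fs' by rewrite -ltnS -szf.
  (* If the stack was refilled in this round, the refill and the merge cancel, and only the number
     of fragments drops. *)
  rewrite /measure szf size_behead; case: sE => [->|[-> ->]] /=; clear -szs fs0; lia.
rewrite -ltNge => lt.
apply: (wp_push inv _ Bb) => //.
- by move=> k k11; rewrite fr2 ?fr1 // (leq_trans k11).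
move=> rf' G' inv'; exists F, [:: b, e & s'], fs, r, m, rf', G'; split=> //.
have [_ _ _ _ [_ ds' _]] := inv'; have szs' := descending_size ds'.
rewrite /measure /=; case: sE => [->|[-> E]] /=; [|rewrite E in szs' *]; move: szs' => /=; clear; lia.
Qed.


(** * Initialization, all rounds, and the output of the tour *)

Lemma wp_initialize rf G Q : rf 0 = Int n -> (forall k, 0 < k -> rf k = Int 0) ->
  (forall x, G 0 (ix x) = Site x) -> (forall x, G 2 (ix x) = Int 0) ->
  (forall rf' G', base rf' -> rf' 8 = Int n.-1 -> rf' 9 = Int 0 -> rf' 10 = Int 0 ->
     (forall x, G' 0 (ix x) = Site x) -> (forall x, G' 1 (ix x) = Int (ix x)) ->
     (forall x, G' 2 (ix x) = Int 0) -> Q (State rf' (arrays G'))) ->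
  wp initialize Q (State rf (arrays G)).
Proof.
move=> R0 Rk G0 G2 HQ.
have [R1 R9 R10 R19] : [/\ rf 1 = Int 0, rf 9 = Int 0, rf 10 = Int 0 & rf 19 = Int 0].
  by rewrite !Rk.
wconst; wconst; wadd; wadd; wadd; wadd.
wsub.
pose J i st := exists rf' G', [/\ st = State rf' (arrays G'), base rf',
  [/\ rf' 8 = Int n.-1, rf' 9 = Int 0, rf' 10 = Int 0 & rf' 19 = Int i] &
  [/\ forall x, G' 0 (ix x) = Site x, forall x, ix x < i -> G' 1 (ix x) = Int (ix x) &
      forall x, G' 2 (ix x) = Int 0]].
apply: (wp_for (J := J)).
- by move=> i st [rf' [G' [-> [R00 _ _ _ _] [_ _ _ R19'] _]]].
- move=> i st ltin [rf' [G' [-> B [R8' R9' R10' R19'] [G0' G1' G2']]]].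
  have [y yi] := ix_surj ltin; rewrite -{}yi in R19' G1' *.
  have [R0' _ R2' _ _] := B.
  wadd; first by rewrite -[X in X + _]mul1n; apply: fits_index.
  wwrite 1 (ix y) (Int (ix y) : word).
  wadd; first exact: fits_next.
  eexists _, _; split; first by [].
  + by apply: base_frame B => k k8; rewrite /update; do 8 case: k k8 => // k k8.
  + by split; rewrite /update //= addn1.
  split=> // x; rewrite ltnS leq_eqVlt => /predU1P[->|xy].
    by rewrite /store /= eqxx.
  by rewrite /store /= ltn_eqF // G1'.
- move=> st [rf' [G' [-> B [R8' R9' R10' _] [G0' G1' G2']]]].
  by apply: HQ => // x; apply: G1'.
- eexists _, _; split; first by [].
  + rewrite /base /update /= R0 R1.
    by do 2![split=> //]; congr Int; clear; lia.
  + by split; rewrite /update /= ?subn1.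
  + by split.
Qed.

Lemma wp_rounds F s fs r m rf G Q : invariant F s fs r m rf G ->
  (forall F' s' fs' r' m' rf' G', invariant F' s' fs' r' m' rf' G' -> size fs' <= 1 ->
     Q (State rf' (arrays G'))) ->
  wp (While (LtInt 1 8) round) Q (State rf (arrays G)).
Proof.
move=> inv HQ.
pose I k st := exists F s fs r m rf G,
  [/\ st = State rf (arrays G), invariant F s fs r m rf G & measure s fs = k].
apply: (wp_while (I := I)); last by exists F, s, fs, r, m, rf, G.
- move=> k st [F1 [s1 [fs1 [r1 [m1 [rf1 [G1 [-> inv1 <-]]]]]]]].
  have [[_ R1 _ _ _] [R8 _ _] _ _ _] := inv1.
  rewrite /= R1 R8; case: (ltnP 1 (size fs1)) => sz; [right|left].
    split; first by case: (size fs1) sz => [|[|q]].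
    apply: wp_conseq (wp_round inv1 sz) => st' [F2 [s2 [fs2 [r2 [m2 [rf2 [G2 [-> inv2 lt]]]]]]]].
    by exists (measure s2 fs2) => //; exists F2, s2, fs2, r2, m2, rf2, G2.
  split; last exact: (HQ _ _ _ _ _ _ _ inv1 sz).
  by case: (size fs1) sz => [|[]].
(* There are at most [n] fragments, so the measure is at most [4 * n]: this is the linear bound on
   the number of rounds. *)
- have [_ _ _ Ffs _] := inv; have := fragments_size Ffs.
  by rewrite /measure; clear; lia.
Qed.

Lemma wp_write_tour F s fs r m rf G Q : invariant F s fs r m rf G -> size fs = 1 ->
  (forall rf' G' p, perm_eq p (enum S) -> sorted (adj F) p ->
     (forall i, i < n -> G' 0 i = Site (nth r p i)) -> Q (State rf' (arrays G'))) ->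
  wp write_tour Q (State rf (arrays G)).
Proof.
move=> [B [R8 R9 R10] [G0 G1 G2 _] Ffs [_ _ Er]] sz HQ.
have [p [pp sp p0 walk]] := fragments_walk Ffs sz Er.
have R0 : rf 0 = Int n by case: B.
wconst; wconst.
(* Current and previous index are specified only for [i < n], as there is no site after the last
   one. *)
pose J i st := exists rf' G' x y, [/\ st = State rf' (arrays G'), base rf',
  [/\ rf' 10 = Int x, rf' 11 = Int y & rf' 19 = Int i],
  i < n -> x = ix (nth r p i) /\ y = (if i is j.+1 then ix (nth r p j) else 0) &
  [/\ forall x, G' 0 (ix x) = Site x, forall x, G' 2 (ix x) = Int (link ix F x) &
      forall j, j < i -> G' 5 j = Site (nth r p j)]].
eapply wp_seq; apply: (wp_for (J := J)).
- by move=> i st [rf' [G' [x [y [-> [R00 _ _ _ _] [_ _ R19'] _ _]]]]].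
- move=> i st ltin [rf' [G' [x [y [-> B' [R10' R11' R19'] xy [G0' G2' G5']]]]]].
  have {xy}[xE yE] := xy ltin.
  have [z zi] := ix_surj ltin.
  have [R0' _ R2' _ [R4' _ _ R7']] := B'.
  wread 0 (ix (nth r p i)) (Site (nth r p i) : word).
    by rewrite xE.
  wadd; first by rewrite -zi; apply: fits_index.
  wwrite 5 i (Site (nth r p i) : word).
  wadd; first by rewrite xE; apply: fits_index.
  wread 2 (ix (nth r p i)) (Int (link ix F (nth r p i)) : word).
    by rewrite xE.
  wsub.
    rewrite (leq_ltn_trans (leq_subr _ _)) // (leq_ltn_trans (link_bound ix_lt _ Ffs)) //.
    by clear; lia.
  wmove; wmove.
  wadd; first by rewrite -zi; apply: fits_next.
  eexists _, _, (link ix F (nth r p i) - y), x; split; first by [].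
  + by apply: base_frame B' => k k8; rewrite /update; do 8 case: k k8 => // k k8.
  + by split; rewrite /update //= ?addn1.
  + by move=> lti; rewrite walk // lti -yE xE addKn.
  split=> // j; rewrite ltnS leq_eqVlt => /predU1P[->|ji].
    by rewrite /store /= eqxx.
  by rewrite /store /= ltn_eqF // G5'.
- move=> st [rf' [G' [x [y [-> B' [R10' R11' R19'] _ [_ _ G5']]]]]].
  wconst.
  pose K i st := exists rf' G', [/\ st = State rf' (arrays G'), base rf', rf' 19 = Int i,
    forall j, j < n -> G' 5 j = Site (nth r p j) &
    forall j, j < i -> G' 0 j = Site (nth r p j)].
  apply: (wp_for (J := K)).
  + by move=> i st' [rf1 [G3 [-> [R00 _ _ _ _] R19 _ _]]].
  + move=> i st' ltin [rf1 [G3 [-> B1 R19 G5 G03]]].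
    have [z zi] := ix_surj ltin.
    have [R0' _ R2' _ [R4' _ _ R7']] := B1.
    wadd; first by rewrite -zi; apply: fits_index.
    wread 5 i (Site (nth r p i) : word); first exact: G5.
    wwrite 0 i (Site (nth r p i) : word).
    wadd; first by rewrite -zi; apply: fits_next.
    eexists _, _; split; first by [].
    * by apply: base_frame B1 => k k8; rewrite /update; do 8 case: k k8 => // k k8.
    * by rewrite /update /= addn1.
    * by [].
    move=> j; rewrite ltnS leq_eqVlt => /predU1P[->|ji].
      by rewrite /store /= eqxx.
    by rewrite /store /= ltn_eqF // G03.
  + by move=> st' [rf1 [G3 [-> B1 R19 G5 G03]]]; apply: HQ pp sp G03.
  + eexists _, _; split; first by [].
    * by apply: base_frame B' => k k8; rewrite /update; do 8 case: k k8 => // k k8.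
    * by [].
    * by [].
    * by [].
- eexists _, _, (ix r), 0; split; first by [].
  + by apply: base_frame B => k k8; rewrite /update; do 8 case: k k8 => // k k8.
  + by [].
  + by rewrite p0.
  + by split.
Qed.

(** Ties are broken by [edge_order]. The greedy edges then contain those of [F], so a path along [F]
    is a path along them. *)
Lemma good_tour F p : good d F -> perm_eq p (enum S) -> sorted (adj F) p -> mf_tour d p.
Proof.
move=> gF pp sp; exists (edge_order d F), p, 0; split; rewrite ?rot0 //.
  exact: sorted_edge_order.
by apply: sub_sorted sp; apply: mf_edges_good.
Qed.

Lemma wp_multiple_fragment rf G : rf 0 = Int n -> (forall k, 0 < k -> rf k = Int 0) ->
  (forall x, G 0 (ix x) = Site x) -> (forall x, G 2 (ix x) = Int 0) ->
  wp multiple_fragment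
    (fun st => exists t, [seq Defs.mem st i | i <- iota 0 n] = map Site t /\ mf_tour d t)
    (State rf (arrays G)).
Proof.
move=> R0 Rk G0 G2; apply: wp_seq; apply: wp_initialize => // {R0 Rk G0 G2}rf {}G.
move=> B R8 R9 R10 G0 G1 G2.
have [R0 R1 R2 R3 _] := B.
(* Without sites there is no endpoint [r] to state the invariant with, so this case is run
   separately. *)
case: (posnP n) => [n0|n0].
  apply: wp_seq; apply: wp_while_done; first by rewrite /= R8 R1 n0.
  have en : enum S = [::] by apply: size0nil; rewrite -cardE n0.
  have tour : exists t, [seq Defs.mem (State rf (arrays G)) i | i <- iota 0 n] = map Site t /\ mf_tour d t.
    exists [::]; rewrite n0; split=> //; apply: (@good_tour [::]) => //.
    by rewrite en.
  wconst; wconst.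
  apply: wp_seq; apply: wp_while_done; first by rewrite /= /update /= R0 n0.
  wconst.
  apply: wp_while_done; first by rewrite /= /update /= R0 n0.
  exact: tour.
have [r r0] := ix_surj n0.
have Er : endpoint [::] r by rewrite /endpoint eq_card0 // => z; rewrite !inE.
have inv : invariant [::] [::] [seq [:: x] | x <- enum S] r ix rf G.
  split=> //.
  - by rewrite size_map -cardE r0; split.
  - by split=> // x; rewrite G2 link_nil.
  - exact: fragments_init.
apply: wp_seq; apply: wp_rounds inv _ => F s fs r1 m rf1 G' inv sz.
have [_ _ _ Ffs [gF _ _]] := inv.
apply: (wp_write_tour inv).
  apply/eqP; rewrite eqn_leq sz lt0n; apply/eqP => /size0nil fs0.
  by have [f] := fragments_mem r Ffs; rewrite fs0.
move=> rf2 G3 p pp sp G30; exists p; split; last exact: good_tour pp sp.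
have szp : size p = n by rewrite (perm_size pp) -cardE.
apply: (@eq_from_nth _ (Int 0)); rewrite !size_map size_iota ?szp // => i ltin.
rewrite (nth_map 0) ?size_iota // nth_iota // (nth_map r1) ?szp //= add0n.
by rewrite -(G30 _ ltin) -(arraysE G3 0 ltin) mul0n add0n.
Qed.

End Wp.

(** * Asymptotics *)

Fixpoint loop_depth (P : program) : nat :=
  match P with
  | Skip | Do _ => 0
  | Seq P Q | If _ P Q => maxn (loop_depth P) (loop_depth Q)
  | While _ P => (loop_depth P).+1
  end.

(** Each level of loop nesting costs one factor. The base is [n.+1] so that the power stays positive
    at [n = 0]. *)
Lemma time_loop_depth P : exists c, forall n, time n P <= c * n.+1 ^ loop_depth P.
Proof.
have mono a b n : a <= b -> n.+1 ^ a <= n.+1 ^ b by move=> ab; rewrite leq_pexp2l.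
elim: P => [|i|P [c cP] Q [c' cQ]|t P [c cP] Q [c' cQ]|t P [c cP]] /=.
- by exists 0.
- by exists 1.
- exists (c + c') => n; rewrite mulnDl leq_add //.
  + by apply: leq_trans (cP n) _; rewrite leq_mul2l mono ?leq_maxl ?orbT.
  + by apply: leq_trans (cQ n) _; rewrite leq_mul2l mono ?leq_maxr ?orbT.
- exists (c + c').+1 => n; rewrite mulSn -add1n leq_add ?expn_gt0 // geq_max mulnDl.
  apply/andP; split.
  + apply: leq_trans (cP n) _; apply: leq_trans (leq_addr _ _).
    by rewrite leq_mul2l mono ?leq_maxl ?orbT.
  + apply: leq_trans (cQ n) _; apply: leq_trans (leq_addl _ _).
    by rewrite leq_mul2l mono ?leq_maxr ?orbT.
- exists (4 * c.+1).+1 => n; rewrite [leqRHS]mulSn -add1n leq_add ?expn_gt0 //.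
  rewrite expnS mulnACA leq_mul //; first by rewrite leq_mul2l leqnSn orbT.
  by rewrite mulSn -add1n leq_add ?expn_gt0.
Qed.

Section Asymptotics.
Variable R : realType.
Local Open Scope ring_scope.
Local Open Scope classical_set_scope.

(** Starting at 3 keeps [ln n] above [ln 2] and lets multiples of [n] absorb additive constants. *)
Lemma eqO_nat (f g : nat -> R) (C : R) : 0 < C ->
  (forall n, (2 < n)%N -> `|f n| <= C * `|g n|) -> f =O_\oo g.
Proof.
move=> C0 H; apply/eqO_exP; exists C => //.
by exists 3%N => // n /= n3; apply: H.
Qed.

Lemma ln2_le n : (2 < n)%N -> ln 2 <= ln n%:R :> R.
Proof. by move=> n2; rewrite ler_ln ?posrE ?ltr0n ?ler_nat // ltnW // (ltn_trans _ n2). Qed.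

Lemma ln2_gt0 : 0 < ln 2 :> R.
Proof. by rewrite ln_gt0 // ltr1n. Qed.

(** The number of bits of [8 * n + 8], a bound on all integers that the program computes. *)
Definition word_size n := (trunc_log 2 (8 * n + 8)).+1.

Lemma word_size_bigO : (fun n => (word_size n)%:R : R) =O_\oo (fun n => ln n%:R : R).
Proof.
apply: (@eqO_nat _ _ (5 / ln 2)); first by rewrite divr_gt0 ?ln2_gt0.
move=> n n2; have l2 := ln2_le n2; have l0 := ln2_gt0.
have n0 : (0 < n)%N by apply: leq_trans n2.
rewrite ger0_norm // ger0_norm; last by apply: le_trans l2; apply: ltW.
rewrite mulrAC ler_pdivlMr // /word_size.
set t := trunc_log _ _.
(* For [n >= 3], [8 * n + 8 <= 27 * n <= n ^ 4]. The fifth [ln n] in the constant pays for the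
   successor in [word_size]. *)
have le : (2 ^ t <= n ^ 4)%N.
  apply: leq_trans (trunc_logP _ _) _ => //; first by rewrite addn_gt0 orbT.
  apply: (@leq_trans (3 ^ 3 * n)%N); first by clear -n2; lia.
  by rewrite (expnSr n 3) leq_mul2r leq_exp2r // n2 orbT.
have : ln (2 ^+ t) <= ln (n%:R ^+ 4) :> R.
  by rewrite ler_ln ?posrE ?exprn_gt0 ?ltr0n // -!natrX ler_nat.
rewrite !lnXn ?ltr0n // -[ln 2 *+ t]mulr_natl -[_ *+ 4]mulr_natl => le'.
have -> : 5 * ln n%:R = 4 * ln n%:R + ln n%:R :> R.
  by rewrite -[X in _ + X]mul1r -mulrDl natr1.
by rewrite -addn1 natrD mulrDl mul1r lerD.
Qed.

Lemma time_le : exists2 C : nat, (0 < C)%N & forall n, (2 < n)%N ->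
  (time n multiple_fragment <= C * n ^ 2)%N.
Proof.
have [c cP] := time_loop_depth multiple_fragment.
exists (c * 4).+1 => // n n2; apply: leq_trans (cP n) _.
(* The deepest nesting is a pass over the sites inside the loop of rounds. The factor 4 comes from
   [n + 1 <= 2 * n]. *)
rewrite (_ : loop_depth _ = 2%N) //.
apply: (@leq_trans (c * 4 * n ^ 2)); last by rewrite leq_mul2r leqnSn orbT.
rewrite -mulnA leq_mul2l -(expnMn 2 n 2) leq_exp2r // mul2n -addnn -addn1 leq_add2l.
by rewrite (leq_trans _ n2) ?orbT.
Qed.

End Asymptotics.

Lemma implements_multiple_fragment (R : realType) :
  implements_mf R multiple_fragment (time^~ multiple_fragment) (fun n => 6 * n) word_size.
Proof.
move=> S d s d_sym ps n; rewrite {}/n.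
have large : 8 * #|S| + 8 < 2 ^ word_size #|S| by apply: trunc_log_ltn.
have ssz : size s = #|S| by rewrite (perm_size ps) -cardE.
have ins x : x \in s by rewrite (perm_mem ps) mem_enum.
have us : uniq s by rewrite (perm_uniq ps) enum_uniq.
split; first exact: leq_pmull.
  by apply: ltn_trans large; clear; lia.
(* The default [Int 0] is also the initial content of the cells beyond the input, so the neighbour
   sums start at 0. *)
pose G j i : word S R := nth (Int 0) (map Site s) (j * #|S| + i).
have -> : init_state R s = State (fun r => if r == 0 then Int (size s) else Int 0) (arrays G).
  rewrite /init_state; congr State; apply/funext => a.
  by rewrite /arrays /G -divn_eq.
pose ix x := index x s.
have ix_inj : injective ix by move=> x y /(congr1 (nth x s)); rewrite !nth_index.
have ix_lt x : ix x < #|S| by rewrite -ssz index_mem.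
have ix_surj i : i < #|S| -> exists x, ix x = i.
  rewrite -ssz => lt; case: s lt us {ssz ps ins G ix_inj ix_lt} @ix => // x s' lt us ix.
  by exists (nth x (x :: s') i); rewrite /ix index_uniq.
have [||x|x|k [st [ex tk [t [mt tour]]]]] := wp_multiple_fragment
  (fun k (kn : k < 8 * #|S| + 8) => ltn_trans kn large) ix_inj ix_lt ix_surj d_sym
  (rf := fun r => if r == 0 then Int (size s) else Int 0) (G := G).
- by rewrite ssz.
- by case.
- by rewrite /G mul0n add0n (nth_map x) ?index_mem // nth_index.
- by rewrite /G nth_default // size_map ssz; clear; lia.
by exists k, st, t; split.
Qed.

Local Open Scope classical_set_scope.
Local Open Scope ring_scope.

Theorem theorem4 (R : realType) :
  (exists (P : program) (T M w : nat -> nat),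
     [/\ implements_mf R P T M w,
         (fun n : nat => (T n)%:R : R) =O_\oo (fun n : nat => n%:R ^+ 2 : R) &
         (fun n : nat => (w n)%:R : R) =O_\oo (fun n : nat => ln n%:R : R)])
  /\
  (exists (P : program) (T M w : nat -> nat),
     [/\ implements_mf R P T M w,
         (fun n : nat => (T n)%:R : R)
           =O_\oo (fun n : nat => n%:R ^+ 2 * ln n%:R ^+ 2 : R),
         (fun n : nat => (M n)%:R : R) =O_\oo (fun n : nat => n%:R : R) &
         (fun n : nat => (w n)%:R : R) =O_\oo (fun n : nat => ln n%:R : R)]).
Proof.
have impl := @implements_multiple_fragment R; have wO := word_size_bigO R.
have [C C0 time_C] := time_le.
split; exists multiple_fragment, (time^~ multiple_fragment), (fun n => 6 * n)%N, word_size;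
  split=> //.
- apply: (@eqO_nat _ _ _ C%:R) => [|n n2]; first by rewrite ltr0n.
  by rewrite !ger0_norm ?exprn_ge0 // -natrX -natrM ler_nat; apply: time_C.
- have l0 := ln2_gt0 R.
  (* Since [ln n >= ln 2], the factor [ln n ^+ 2 / ln 2 ^+ 2] is at least 1, and the quadratic bound
     suffices. *)
  apply: (@eqO_nat _ _ _ (C%:R / ln 2 ^+ 2)) => [|n n2].
    by rewrite divr_gt0 ?ltr0n ?exprn_gt0.
  have ll := ln2_le R n2; have ln0 : 0 <= ln n%:R :> R by apply: le_trans ll; apply: ltW.
  rewrite !ger0_norm ?mulr_ge0 ?exprn_ge0 //.
  apply: (@le_trans _ _ (C%:R * n%:R ^+ 2)).
    by rewrite -natrX -natrM ler_nat; apply: time_C.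
  rewrite -[leRHS]mulrA ler_wpM2l // mulrCA ler_peMr ?exprn_ge0 //.
  by rewrite mulrC ler_pdivlMr ?exprn_gt0 // mul1r ler_pXn2r ?nnegrE // ltW.
- apply: (@eqO_nat _ _ _ 6) => // n _.
  by rewrite !ger0_norm // natrM.
Qed.
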